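(* Let $S$ be a connected graph with $S\neq P_3$ and let $G$ be a $2$-connected $K_{1,3}$-$f_1$-heavy graph which is not a cycle. If $S\in\{P_4,Z_1,Z_2\}$ and $G$ is $S$-$f_1$-heavy, then $G$ is pancyclic.
   Context: All graphs are finite and simple. Let $G$ be a graph on $n$ vertices, and $d(x)$ the degree of $x$ in $G$. For a subgraph $H$ and $x,y\in V(H)$, $d_H(x,y)$ is the length of a shortest $(x,y)$-path in $H$. An induced subgraph $H$ of $G$ is called $f_1$-heavy if for every pair of vertices $u,v\in V(H)$ with $d_H(u,v)=2$ we have $\max\{d(u),d(v)\}\geq (n+1)/2$ (degrees taken in $G$). For a graph $R$, $G$ is $R$-$f_1$-heavy if every induced subgraph of $G$ isomorphic to $R$ is $f_1$-heavy. $K_{1,3}$ is the claw, $P_k$ is the path on $k$ vertices, and $Z_i$ is the graph obtained from the path $a_1a_2\cdots a_{i+3}$ by adding the edge $a_1a_3$. A graph on $n$ vertices is pancyclic if it contains cycles of every length from $3$ to $n$. *)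

(* Defs.v *)
From mathcomp Require Import all_boot.
Set Implicit Arguments. Unset Strict Implicit. Unset Printing Implicit Defensive.

Section Graphs.
Variables (T : finType) (e : rel T).

Definition simple_graph := symmetric e /\ irreflexive e.

Definition deg (x : T) : nat := #|[set y | e x y]|.

Definition walk_in (A : {set T}) (u v : T) (k : nat) : Prop :=
  exists p : seq T, [/\ u \in A, size p = k, path e u p,
                        all (fun x => x \in A) p & last u p = v].

Definition dist_in (A : {set T}) (u v : T) (k : nat) : Prop :=
  walk_in A u v k /\ forall j, j < k -> ~ walk_in A u v j.

Definition f1_heavy_set (A : {set T}) : Prop :=
  forall u v, u \in A -> v \in A -> dist_in A u v 2 ->
    #|T|.+1 <= 2 * maxn (deg u) (deg v).

Definition R_f1_heavy (VR : finType) (r : rel VR) : Prop :=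
  forall f : VR -> T, injective f -> (forall x y, e (f x) (f y) = r x y) ->
    f1_heavy_set (f @: [set: VR]).

Definition connected_graph : Prop := forall x y, connect e x y.

Definition two_connected : Prop :=
  [/\ 3 <= #|T|, connected_graph &
      forall v x y, x != v -> y != v ->
        connect (fun a b => [&& e a b, a != v & b != v]) x y].

Definition is_cycle_graph : Prop :=
  exists s : seq T, [/\ uniq s, size s = #|T|, 3 <= #|T| &
    forall x y, e x y = (y == next s x) || (x == next s y)].

Definition pancyclic : Prop :=
  forall k, 3 <= k <= #|T| ->
    exists s : seq T, [/\ size s = k, uniq s & cycle e s].

End Graphs.

Definition claw_rel : rel 'I_4 :=
  fun x y => ((val x == 0) && (val y != 0)) || ((val y == 0) && (val x != 0)).

Definition P_rel (k : nat) : rel 'I_k :=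
  fun x y => (val x == (val y).+1) || (val y == (val x).+1).

Definition Z_rel (i : nat) : rel 'I_(i + 3) :=
  fun x y => [|| val x == (val y).+1, val y == (val x).+1,
                 (val x == 0) && (val y == 2) | (val x == 2) && (val y == 0)].

Arguments P_rel k : clear implicits.
Arguments Z_rel i : clear implicits.

(* Main.v *)
(** A vertex is heavy if twice its degree exceeds n, and light otherwise.  Each
    of the three choices of S implies the same weak condition on induced copies
    of Z_2 ([z2_heavy]), and only this condition and the claw condition are used.

    Hamiltonicity.  Join all heavy vertices to each other and take a cycle of the
    resulting graph through all heavy vertices with as many vertices as possible;
    by a Bondy-Chvatal exchange its vertex set also carries a cycle of G.  A
    vertex x left out is light.  If x is attached to the cycle at u and w, the two
    conditions allow u to be shifted along the cycle until its successor is heavy,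
    and then the same for w; the edge between the two heavy successors then yields
    a longer cycle.  The argument works inside any 2-connected induced subgraph in
    which heavy vertices keep large enough degree sums.

    No heavy vertex.  G is claw-free and Z_2-free, and every cycle of length at
    least 4 can be shortened by exactly one: look at a shortest chord or, if there
    is no chord, at a vertex attached to the cycle.

    Some heavy vertex x.  Let C_k be missing.  Then no Hamilton cycle has two
    consecutive heavy vertices, and no cycle of length n - 1 avoids x, so G - x is
    not 2-connected: on the Hamilton cycle x = v_0, v_1, ..., v_(n-1) some v_s
    separates v_1, ..., v_(s-1) from v_(s+1), ..., v_(n-1).  At most one side contains
    heavy vertices, the claw and Z_2 conditions make the neighbourhoods of x and
    of the next heavy vertex consist of intervals of the cycle, and a cycle of
    length k is then read off.  When x has a single neighbour on one side, counting
    chords of x or deleting x and that neighbour reduces to the same situation. *)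

Require Import Defs.
From mathcomp Require Import all_boot zify.
Set Implicit Arguments. Unset Strict Implicit. Unset Printing Implicit Defensive.

(** * Chains and cycles *)

Section Chains.
Variables (T : eqType) (g : rel T).

(** The two ends are recorded so that arcs of a cycle can be glued and reversed by naming only their
    end vertices. *)
Definition chain (a b : T) (s : seq T) :=
  if s is c :: p then [&& c == a, path g a p & last a p == b] else false.

Lemma chain1 a : chain a a [:: a].
Proof. by rewrite /= !eqxx. Qed.

Lemma chain_cat a b c d s t :
  chain a b s -> chain c d t -> g b c -> chain a d (s ++ t).
Proof.
case: s => // ? s /and3P[/eqP-> ps /eqP ls]; case: t => // ? t /and3P[/eqP-> pt lt] bc.
by rewrite /= eqxx cat_path last_cat ls ps /= bc pt lt.
Qed.

Lemma chain_cons a b c s : chain b c s -> g a b -> chain a c (a :: s).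
Proof. by move=> bs ab; apply: (chain_cat (chain1 a) bs ab). Qed.

Lemma chain_cycle a b s : chain a b s -> g b a -> cycle g s.
Proof.
by case: s => // ? s /and3P[/eqP-> ps /eqP ls] ba; rewrite /= rcons_path ps ls.
Qed.

Lemma cycle_chain a p :
  cycle g (a :: p) -> chain a (last a p) (a :: p) /\ g (last a p) a.
Proof. by rewrite /= rcons_path !eqxx /= andbT => /andP[]. Qed.

Lemma chain_rev a b s : symmetric g -> chain a b s -> chain b a (rev s).
Proof.
move=> sg; elim: s a => // c s IHs a /and3P[/eqP->].
case: s IHs => [|d s] IHs; first by move=> _ /= /eqP->; apply: chain1.
rewrite [path _ _ _]/= => /andP[ad ps] ls; rewrite rev_cons -cats1.
apply: (@chain_cat b d a a); last by rewrite sg.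
  by apply: IHs; rewrite /= eqxx ps.
exact: chain1.
Qed.

Lemma cycle_split u w A B : A != [::] -> B != [::] -> cycle g (u :: A ++ w :: B) ->
  exists a a' b b', [/\ chain a a' A, chain b b' B, g u a /\ g a' w & g w b /\ g b' u].
Proof.
case: A => // a A _; case: B => // b B _.
rewrite /= rcons_cat cat_path /= rcons_path.
case/and4P => ua pA aw /and3P[wb pB bu].
by exists a, (last a A), b, (last b B); split; rewrite /= ?eqxx ?pA ?pB.
Qed.

End Chains.

Lemma sub_chain (T : eqType) (g g' : rel T) a b s :
  subrel g g' -> chain g a b s -> chain g' a b s.
Proof.
move=> gg'; case: s => //= c s /and3P[-> ps ->].
by rewrite (sub_path gg' ps).
Qed.
Lemma chain_mem (T : eqType) (g : rel T) a b s : chain g a b s -> (a \in s) && (b \in s).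
Proof.
by case: s => // c s /and3P[/eqP-> _ /eqP<-]; rewrite mem_head mem_last.
Qed.

Lemma pathPn (T : eqType) (g : rel T) x p : ~~ path g x p ->
  exists p1 y p2, p = p1 ++ y :: p2 /\ ~~ g (last x p1) y.
Proof.
elim: p x => //= y p IHp x; have [xy /IHp[p1 [z [p2 [-> zE]]]]|xy _] := boolP (g x y).
  by exists (y :: p1), z, p2.
by exists [::], y, p.
Qed.

Lemma cyclePn (T : eqType) (g : rel T) c : ~~ cycle g c ->
  exists i y p, rot i c = y :: p /\ ~~ g (last y p) y.
Proof.
case: c => // z q /= /pathPn[p1 [y [p2 [qE ng]]]].
case/lastP: p2 qE => [|p2 t].
  by rewrite cats1 => /rcons_inj[qE yE]; subst; exists 0, y, p1; rewrite rot0.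
rewrite -rcons_cons -rcons_cat => /rcons_inj[qE _]; subst q.
exists (size (z :: p1)), y, (p2 ++ z :: p1); split; last by rewrite last_cat.
by rewrite -cat_cons rot_size_cat.
Qed.

Lemma uniq_cycle_clique (T : eqType) (g : rel T) s : 1 < size s -> uniq s ->
  {in s &, forall x y, x != y -> g x y} -> cycle g s.
Proof.
case: s => // x p p0 up gp; have lx : last x p != x.
  case: p p0 up {gp} => //= y p _ /andP[xp _].
  by apply: contraNneq xp => <-; apply: mem_last.
rewrite /= rcons_path gp ?mem_last ?mem_head // andbT.
elim: p x {lx p0} up gp => //= y p IHp x /andP[xp up] gp.
rewrite gp ?inE ?eqxx ?orbT //; last by apply: contraNneq xp => ->; rewrite mem_head.
by apply: IHp => // a b ap bp; apply: gp; rewrite inE ?ap ?bp orbT.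
Qed.

(** Pigeonhole: [P] on the members of [p] and [Q] on their predecessors have together more hits than
    there are positions. *)
Lemma crossing_split (T : eqType) (P Q : pred T) y p :
  size p < count P p + count Q (belast y p) ->
  exists p1 z p2, [/\ p = p1 ++ z :: p2, P z & Q (last y p1)].
Proof.
elim: p y => //= z p IHp y; have [/andP[Pz Qy] _|nPQ lt] := boolP (P z && Q y).
  by exists [::], z, p.
have [|p1 [t [p2 [-> Pt Qt]]]] := IHp z; last by exists (z :: p1), t, p2.
by move: nPQ lt; case: (P z); case: (Q y) => //= _; lia.
Qed.

Ltac perm_solve := clear; apply/permP => ?; rewrite /= ?(count_cat, count_rev) /= ?(count_cat, count_rev) /=; lia.


(* [lia] treats every boolean hypothesis as a propositional atom, which is
   exponential in their number; only the arithmetic ones are kept. *)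
Ltac nat_only := repeat match goal with H : ?P |- _ =>
  lazymatch type of P with Prop => lazymatch P with
    | is_true (leq _ _) => fail
    | is_true (andb (leq _ _) _) => fail
    | is_true (negb (@eq_op ?A _ _)) => tryif unify (Equality.sort A) nat then fail else clear H
    | @eq ?A _ _ => tryif unify A nat then fail else clear H
    | _ => clear H
  end end end.

Ltac idx := nat_only; lia.

(** * Hamiltonicity *)

Section PointwiseConditions.
Variables (T : finType) (e : rel T) (H : pred T).

(** An induced claw has at most one light leaf, since any two leaves are at distance two. *)
Definition claw_heavy := forall c a b d, e c a -> e c b -> e c d ->
  a != b -> d != a -> d != b -> ~~ H a -> ~~ H b -> ~~ e a b -> e a d || e b d.

(* The requirement on the pair (a3, a5) of an induced Z_2 is dropped, so that
   the condition also follows from the ones for P_4 and Z_1. *)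
Definition z2_heavy := forall a1 a2 a3 a4 a5,
  e a1 a2 -> e a1 a3 -> e a2 a3 -> e a3 a4 -> e a4 a5 ->
  ~~ e a1 a4 -> ~~ e a2 a4 -> ~~ H a4 -> ~~ (H a1 && H a2) ->
  [|| e a1 a5, e a2 a5 | e a3 a5].

End PointwiseConditions.

Section Hamiltonicity.
Variables (T : finType) (e : rel T) (H : pred T) (U : {set T}).
Hypotheses (sym : symmetric e) (irr : irreflexive e).
Hypotheses (clawH : claw_heavy e H) (z2H : z2_heavy e H).

Definition heavy_join : rel T := fun u v => e u v || [&& H u, H v & u != v].

Lemma heavy_join_sym : symmetric heavy_join.
Proof. by move=> u v; rewrite /heavy_join sym [H u && _]andbCA eq_sym. Qed.

Lemma sub_heavy_join : subrel e heavy_join.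
Proof. by move=> u v uv; rewrite /heavy_join uv. Qed.

(** * Cycles that cannot be extended in the graph with joined heavy vertices *)

Section Extension.
Variable s : seq T.
Hypotheses (us : uniq s) (sU : {subset s <= U}).
Hypothesis Hs : forall h, h \in U -> H h -> h \in s.
Hypothesis s_max : forall s', uniq s' -> cycle heavy_join s' ->
  {subset s' <= U} -> {subset s <= s'} -> size s' <= size s.

(** Only the vertex set of [s] matters, hence the arbitrary rearrangement [t]; each exchange below
    produces a cycle [c] with extra vertices [z]. *)
Lemma no_extension t z c : perm_eq t s -> z != [::] -> uniq z ->
  {subset z <= U} -> ~~ has (mem s) z -> perm_eq c (z ++ t) ->
  cycle heavy_join c -> False.
Proof.
move=> ts z0 uz zU zs cz cyc.
have cs : perm_eq c (z ++ s) by rewrite (permPl cz) perm_cat2l.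
have: size c <= size s.
  apply: s_max => //.
  - by rewrite (perm_uniq cs) cat_uniq uz us andbT -has_sym.
  - by move=> y; rewrite (perm_mem cs) mem_cat => /orP[/zU|/sU].
  - by move=> y ys; rewrite (perm_mem cs) mem_cat ys orbT.
by rewrite (perm_size cs) size_cat; case: z z0 {uz zU zs cz cs} => //= *; lia.
Qed.

Lemma no_extension1 t x c : perm_eq t s -> x \in U -> x \notin s ->
  perm_eq c (x :: t) -> cycle heavy_join c -> False.
Proof.
move=> ts xU xs cx; apply: (@no_extension t [:: x]) => //=; last by rewrite orbF.
by move=> y; rewrite inE => /eqP->.
Qed.

Lemma outside_light x : x \in U -> x \notin s -> ~~ H x.
Proof. by move=> xU; apply: contra => /(Hs xU). Qed.

Lemma no_insertion u y r x : cycle heavy_join (u :: y :: r) ->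
  perm_eq (u :: y :: r) s -> x \in U -> x \notin s -> e x u -> ~~ e x y.
Proof.
move=> /= cyc ps xU xs xu; apply/negP => xy.
apply: (no_extension1 ps xU xs (c := [:: u, x, y & r])); first by perm_solve.
rewrite /= [X in X && _]/heavy_join sym xu /= [X in X && _]/heavy_join xy /=.
by case/andP: cyc.
Qed.

Lemma no_insertion_last u y r x : cycle heavy_join (u :: y :: r) ->
  perm_eq (u :: y :: r) s -> x \in U -> x \notin s -> e x u -> ~~ e x (last y r).
Proof.
move=> cyc ps xU xs xu; apply/negP => xl; move: (cyc) => /cycle_chain[ch _].
apply: (no_extension1 ps xU xs (perm_refl [:: x, u, y & r])).
apply: (chain_cycle (chain_cons ch (sub_heavy_join xu))).
by rewrite /= heavy_join_sym sub_heavy_join.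
Qed.

(* Otherwise [u], [x] and the two neighbours of [u] on the cycle form a claw with
   two light leaves. *)
Lemma attached_neighbours u y r x : cycle e (u :: y :: r) -> r != [::] ->
  perm_eq (u :: y :: r) s -> x \in U -> x \notin s -> e x u ->
  heavy_join y (last y r).
Proof.
move=> cyc r0 ps xU xs xu.
have cyc' := sub_cycle sub_heavy_join cyc.
have xy := no_insertion cyc' ps xU xs xu.
have xl := no_insertion_last cyc' ps xU xs xu.
have xL := outside_light xU xs.
have [uy ul] : e u y /\ e u (last y r).
  by move: cyc; rewrite /= rcons_path => /and3P[-> _]; rewrite sym.
have yl : y != last y r.
  have : uniq (u :: y :: r) by rewrite (perm_uniq ps).
  case/lastP: r r0 {cyc cyc' ps xl ul} => // r z _; rewrite last_rcons /= mem_rcons.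
  by rewrite inE negb_or => /and3P[_ /andP[]].
have xnot z : z \in u :: y :: r -> z != x.
  by rewrite (perm_mem ps); apply: contraTneq => ->.
have [ny nl] : y != x /\ last y r != x by rewrite !xnot // inE ?mem_last ?mem_head orbT.
rewrite /heavy_join yl andbT; case ylE: (e y (last y r)) => //=.
apply/andP; split; apply: contraFT ylE => hL.
  have := clawH (_ : e u x) uy ul; rewrite eq_sym ny sym xu nl eq_sym yl.
  by move/(_ isT isT isT isT xL hL xy); rewrite (negPf xl).
have := clawH (_ : e u x) ul uy; rewrite eq_sym nl sym xu ny yl.
by move/(_ isT isT isT isT xL hL xl); rewrite (negPf xy) /= sym.
Qed.

Lemma rot_cat_cons (u : T) A w B : perm_eq (u :: A ++ w :: B) (w :: B ++ u :: A).
Proof. perm_solve. Qed.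

Lemma cycle_swap (g : rel T) u A w B :
  cycle g (u :: A ++ w :: B) = cycle g (w :: B ++ u :: A).
Proof. by rewrite -(rot_cycle (size (u :: A))) -cat_cons rot_size_cat. Qed.

Lemma arc_nonempty u A w B x : cycle e (u :: A ++ w :: B) ->
  perm_eq (u :: A ++ w :: B) s -> x \in U -> x \notin s -> e x u -> e x w ->
  A != [::].
Proof.
case: A => // cyc ps xU xs xu.
by rewrite (negPf (no_insertion (sub_cycle sub_heavy_join cyc) ps xU xs xu)).
Qed.

Lemma attached_ends u A w B x a a' b b' : cycle e (u :: A ++ w :: B) ->
  perm_eq (u :: A ++ w :: B) s -> x \in U -> x \notin s -> e x u ->
  chain e a a' A -> chain e b b' B ->
  [/\ heavy_join a b', ~~ e x a & ~~ e x b'].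
Proof.
move=> cyc ps xU xs xu; case: A cyc ps => // c A cyc ps /and3P[/eqP cE _ _]; subst c.
case: B cyc ps => // c B cyc ps /and3P[/eqP cE _ /eqP lB]; subst c.
have := attached_neighbours cyc _ ps xU xs xu.
have := no_insertion_last (sub_cycle sub_heavy_join cyc) ps xU xs xu.
have := no_insertion (sub_cycle sub_heavy_join cyc) ps xU xs xu.
rewrite last_cat /= lB => -> -> -> //.
by case: A {cyc ps}.
Qed.

Lemma attached_ends2 u A w B x a a' b b' : cycle e (u :: A ++ w :: B) ->
  perm_eq (u :: A ++ w :: B) s -> x \in U -> x \notin s -> e x w ->
  chain e a a' A -> chain e b b' B ->
  [/\ heavy_join b a', ~~ e x b & ~~ e x a'].
Proof.
rewrite cycle_swap => cyc ps xU xs xw Ac Bc.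
apply: (attached_ends cyc _ xU xs xw Bc Ac).
by rewrite -(permPl (rot_cat_cons _ _ _ _)).
Qed.

(* The path [P] outside joins [u] to [w]; rerouting along [rev A] uses the new
   edge between the successors of [u] and [w]. *)
Lemma no_crossing u A w B P p p' a a' b b' : cycle heavy_join (u :: A ++ w :: B) ->
  perm_eq (u :: A ++ w :: B) s ->
  chain heavy_join p p' P -> uniq P -> {subset P <= U} -> ~~ has (mem s) P ->
  heavy_join u p -> heavy_join p' w ->
  chain heavy_join a a' A -> chain heavy_join b b' B -> ~~ heavy_join a b.
Proof.
move=> cyc ps Pc uP PU Ps up pw Ac Bc; apply/negP => ab.
have [A0 B0] : A != [::] /\ B != [::] by split; [case: A Ac {cyc ps}|case: B Bc {cyc ps}].
have [a1 [a1' [b1 [b1' [Ac1 Bc1 [ua aw] [wb bu]]]]]] := cycle_split A0 B0 cyc.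
have [aE a'E] : a1 = a /\ a1' = a'.
  by case: A Ac Ac1 {cyc ps A0} => // c A /and3P[/eqP<- _ /eqP<-] /and3P[/eqP<- _ /eqP<-].
have [bE b'E] : b1 = b /\ b1' = b'.
  by case: B Bc Bc1 {cyc ps B0} => // c B /and3P[/eqP<- _ /eqP<-] /and3P[/eqP<- _ /eqP<-].
subst.
have P0 : P != [::] by case: P Pc {uP PU Ps}.
apply: (no_extension ps P0 uP PU Ps (c := u :: P ++ w :: rev A ++ B)).
  by perm_solve.
have Ar := chain_rev heavy_join_sym Ac.
apply: (@chain_cycle _ _ u b'); last by [].
apply: chain_cons up; apply: chain_cat Pc _ pw.
apply: (chain_cons (b := a')); last by rewrite heavy_join_sym.
exact: chain_cat Ar Bc ab.
Qed.

(* While the successor [y1] of [u] is light, [w] and the vertex after [y1] are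
   adjacent to [u], so [u] can be moved one step forward, past [y1]. *)
Lemma push_to_heavy A u w B x : cycle e (u :: A ++ w :: B) ->
  perm_eq (u :: A ++ w :: B) s -> x \in U -> x \notin s -> e x u -> e x w ->
  exists pre h A', [/\ A = pre ++ h :: A', H h &
    cycle e (u :: (h :: A') ++ w :: B ++ pre)].
Proof.
move=> cyc ps xU xs xu xw; elim: A B cyc ps => [|y1 A IHA] B cyc ps.
  by have := arc_nonempty cyc ps xU xs xu xw.
have [y1H|y1L] := boolP (H y1).
  by exists [::], y1, A; rewrite cats0.
have B0 : B != [::].
  move: cyc ps; rewrite cycle_swap (permPl (rot_cat_cons _ _ _ _)) => cyc ps.
  exact: arc_nonempty cyc ps xU xs xw xu.
have xL := outside_light xU xs.
have cyc' := sub_cycle sub_heavy_join cyc.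
have [c [a' [b [b' [Ac Bc [uy aw] [wb bu]]]]]] := cycle_split (isT : y1 :: A != [::]) B0 cyc.
have cE : c = y1 by case/andP: Ac => /eqP.
subst c.
have [y1b xy1 xb'] := attached_ends cyc ps xU xs xu Ac Bc.
have [ba' xb xa'] := attached_ends2 cyc ps xU xs xw Ac Bc.
have Ac' := sub_chain sub_heavy_join Ac.
have Bc' := sub_chain sub_heavy_join Bc.
have ux' : heavy_join u x by rewrite sub_heavy_join // sym.
have xw' := sub_heavy_join xw; have aw' := sub_heavy_join aw.
have y1b' : e y1 b' by case/orP: y1b => // /and3P[]; rewrite (negPf y1L).
(* The arcs could be run through as [u], [x], [w], then [y1] to [a'], then [b] to [b']. *)
have wy1 : ~~ e w y1.
  apply/negP => wy1; apply: (no_extension1 ps xU xs (c := u :: x :: w :: (y1 :: A) ++ B)).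
    by perm_solve.
  apply: (@chain_cycle _ _ u b'); last exact: sub_heavy_join.
  apply: chain_cons ux'; apply: chain_cons xw'; apply: chain_cons (sub_heavy_join wy1).
  by apply: chain_cat Ac' Bc' _; rewrite heavy_join_sym.
have wb' : ~~ e w b'.
  apply/negP => wb'.
  apply: (no_extension1 ps xU xs (c := u :: x :: w :: rev B ++ rev (y1 :: A))).
    by perm_solve.
  apply: (@chain_cycle _ _ u y1); last by rewrite heavy_join_sym sub_heavy_join.
  apply: chain_cons ux'; apply: chain_cons xw'; apply: chain_cons (sub_heavy_join wb').
  have Ar := chain_rev heavy_join_sym Ac'; have Br := chain_rev heavy_join_sym Bc'.
  exact: chain_cat Br Ar ba'.
(* Triangle [y1], [b'], [u] with tail [x], [w]: as [w] sees neither [y1] nor [b'], it sees [u]. *)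
have uw : e u w.
  have := z2H y1b' (_ : e y1 u) bu (_ : e u x) xw.
  rewrite sym uy sym xu [e y1 x]sym xy1 [e b' x]sym xb' xL (negPf y1L) ![e _ w]sym.
  by rewrite (negPf wy1) (negPf wb') /=; apply.
case: A Ac Ac' IHA cyc ps cyc' => [|y2 A] Ac Ac' IHA cyc ps cyc'.
  by case/and3P: Ac => _ _ /= /eqP a'E; rewrite sym a'E aw in wy1.
have y12 : e y1 y2 by case/and3P: Ac => _ /andP[].
have Ac2 : chain e y2 a' (y2 :: A).
  by move: Ac; rewrite /= !eqxx /= => /andP[/andP[_ ->] ->].
have Ac2' := sub_chain sub_heavy_join Ac2.
(* Otherwise the cycle neighbours [y1] and [y3] of [y2] are joined, and the order [u], [x], [y2],
   [y1], [y3] absorbs [x]. *)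
have xy2 : ~~ e x y2.
  apply/negP => xy2.
  have [y3 [R RE]] : exists y3 R, A ++ w :: B = y3 :: R.
    by case: (A) => [|y3 A']; [exists w, B | exists y3, (A' ++ w :: B)].
  move: cyc ps; rewrite 2!cat_cons RE => cyc ps.
  have psr : perm_eq (y2 :: y3 :: R ++ [:: u; y1]) s.
    by rewrite -(permPr ps); perm_solve.
  have cycr : cycle e (y2 :: y3 :: R ++ [:: u; y1]).
    by move: cyc; rewrite -(rot_cycle 2) /rot /= ?drop0 ?take0 -?catA.
  have := attached_neighbours cycr _ psr xU xs _.
  rewrite last_cat /= xy2 -size_eq0 size_cat addn2 => /(_ isT isT) y31.
  apply: (no_extension1 ps xU xs (c := [:: u, x, y2, y1, y3 & R])).
    by perm_solve.
  move: (sub_cycle sub_heavy_join cyc) => /= /and4P[_ y12' _ pR].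
  by rewrite ux' (sub_heavy_join xy2) [_ y2 y1]heavy_join_sym y12' [_ y1 y3]heavy_join_sym y31.
have wy2 : ~~ e w y2.
  apply/negP => wy2.
  apply: (no_extension1 ps xU xs (c := u :: x :: w :: (y2 :: A) ++ B ++ [:: y1])).
    by perm_solve.
  apply: (@chain_cycle _ _ u y1); last by rewrite heavy_join_sym sub_heavy_join.
  apply: chain_cons ux'; apply: chain_cons xw'; apply: chain_cons (sub_heavy_join wy2).
  have Bc2 : chain heavy_join b y1 (B ++ [:: y1]).
    by apply: chain_cat Bc' (chain1 _ _) _; rewrite heavy_join_sym.
  by apply: chain_cat Ac2' Bc2 _; rewrite heavy_join_sym.
(* Triangle [x], [w], [u] with tail [y1], [y2]. *)
have uy2 : e u y2.
  have := z2H xw xu (_ : e w u) uy y12 xy1 wy1 y1L.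
  by rewrite sym uw (negPf xL) /= (negPf xy2) (negPf wy2) /=; apply.
(* The vertex [y1] moves from the arc after [u] to the end of the arc before it. *)
have [||pre [h [A' [AE hH cycF]]]] := IHA (B ++ [:: y1]).
- apply: (@chain_cycle _ _ u y1); last by rewrite sym.
  apply: chain_cons uy2; apply: chain_cat Ac2 _ aw; apply: chain_cons wb.
  by apply: chain_cat Bc (chain1 _ _) _; rewrite sym.
- by rewrite -(permPr ps); perm_solve.
exists (y1 :: pre), h, A'; split=> //; first by rewrite AE.
by move: cycF; rewrite -catA.
Qed.

(** Two pushes make the successors of [u] and [w] heavy. The second one only appends vertices at the
    end of the arc after [u], so the first heavy successor stays in place; the two are joined and
    [no_crossing] applies to [x] alone. *)
Lemma no_common_attachment A u w B x : cycle e (u :: A ++ w :: B) ->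
  perm_eq (u :: A ++ w :: B) s -> x \in U -> x \notin s -> e x u -> e x w -> False.
Proof.
move=> cyc ps xU xs xu xw.
have [pre [h [A1 [AE hH]]]] := push_to_heavy cyc ps xU xs xu xw.
rewrite cycle_swap => cyc1.
have ps1 : perm_eq (w :: (B ++ pre) ++ u :: h :: A1) s.
  by rewrite -(permPr ps) AE; perm_solve.
have [pre' [h' [B1 [BE h'H]]]] := push_to_heavy cyc1 ps1 xU xs xw xu.
set B2 := h' :: B1; set A2 := (h :: A1) ++ pre' => cyc2.
have ps2 : perm_eq (w :: B2 ++ u :: A2) s.
  by rewrite -(permPr ps1) BE /B2 /A2; perm_solve.
have [c [b' [d [a' [Bc Ac _ _]]]]] :=
  cycle_split (isT : B2 != [::]) (isT : A2 != [::]) cyc2.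
have [cE dE] : c = h' /\ d = h.
  by split; [case/and3P: Bc => /eqP | case/and3P: Ac => /eqP].
subst c d.
have us2 : uniq (w :: B2 ++ u :: A2) by rewrite (perm_uniq ps2).
have := @no_crossing w B2 u A2 [:: x] x x h' b' h a' (sub_cycle sub_heavy_join cyc2) ps2
  (chain1 _ _) isT _ _ _ _ (sub_chain sub_heavy_join Bc) (sub_chain sub_heavy_join Ac).
rewrite /= orbF xs => /(_ _ isT _ _) /negP; apply.
- by move=> z; rewrite inE => /eqP->.
- by rewrite sub_heavy_join // sym.
- exact: sub_heavy_join.
rewrite /heavy_join h'H hH /=; apply/orP; right.
apply: contraTneq us2 => h'h; rewrite /B2 /A2 /= h'h !(mem_cat, inE) eqxx !orbT /=.
by rewrite andbF.
Qed.

(* By [z2H] applied to the triangle formed by [u] and its two neighbours on the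
   cycle, adjacency to [u] propagates along every path outside. *)
Lemma attached_component u A w B x1 x2 a a' b b' : cycle e (u :: A ++ w :: B) ->
  perm_eq (u :: A ++ w :: B) s -> chain e a a' A -> chain e b b' B ->
  ~~ (H a && H b') ->
  connect (fun y z => [&& e y z, y \in U :\: [set t in s] & z \in U :\: [set t in s]]) x1 x2 ->
  x1 \in U -> x1 \notin s -> e x1 u -> e x2 u.
Proof.
move=> cyc ps Ac Bc ab /connectP[p pp ->]; elim: p x1 pp => //= z p IHp x.
case/andP => /and3P[xz _ ]; rewrite !inE => /andP[zs zU] pp xU xs xu.
apply: (IHp z pp zU zs).
have [ha xa xb] := attached_ends cyc ps xU xs xu Ac Bc.
have A0 : A != [::] by case: A Ac {cyc ps}.
have B0 : B != [::] by case: B Bc {cyc ps}.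
have [c [c' [d [d' [Ac1 Bc1 [ua aw] [wb bu]]]]]] := cycle_split A0 B0 cyc.
have [cE d'E] : c = a /\ d' = b'.
  case: (A) Ac Ac1 => // ? ? /andP[/eqP<- _] /andP[/eqP<- _].
  by case: (B) Bc Bc1 => // ? ? /and3P[/eqP<- _ /eqP<-] /and3P[/eqP<- _ /eqP<-].
subst c d'.
have eab : e a b' by case/orP: ha => // /and3P[Ha Hb]; rewrite Ha Hb in ab.
have xz0 : uniq [:: x; z].
  by rewrite /= inE andbT; apply: contraTneq xz => ->; rewrite irr.
have xzU : {subset [:: x; z] <= U} by move=> t; rewrite !inE => /orP[]/eqP->.
have xzs : ~~ has (mem s) [:: x; z] by rewrite /= orbF negb_or xs.
have za : ~~ e z a.
  apply/negP => za.
  apply: (no_extension ps (isT : [:: x; z] != [::]) xz0 xzU xzs (c := [:: u, x, z & A ++ w :: B])).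
    by perm_solve.
  apply: sub_cycle sub_heavy_join _ _.
  apply: (@chain_cycle _ _ u b') => //; apply: (chain_cons (b := x)); last by rewrite sym.
  apply: chain_cons xz; apply: chain_cons za; apply: chain_cat Ac1 _ aw.
  exact: chain_cons Bc1 wb.
have zb : ~~ e z b'.
  apply/negP => zb.
  apply: (no_extension ps (isT : [:: x; z] != [::]) xz0 xzU xzs (c := u :: A ++ w :: B ++ [:: z; x])).
    by perm_solve.
  apply: sub_cycle sub_heavy_join _ _.
  apply: (@chain_cycle _ _ u x) => //; apply: chain_cons ua.
  apply: chain_cat Ac1 _ aw; apply: chain_cons wb.
  apply: chain_cat Bc1 (chain_cons (chain1 _ _) _) _; rewrite sym //.
have := z2H eab (_ : e a u) bu (_ : e u x) xz.
rewrite sym ua sym xu [e a x]sym xa [e b' x]sym xb (outside_light xU xs) ab ![e _ z]sym.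
by rewrite (negPf za) (negPf zb) /=; apply.
Qed.

Lemma path_arc_nonempty u A w B P p p' : cycle heavy_join (u :: A ++ w :: B) ->
  perm_eq (u :: A ++ w :: B) s ->
  chain heavy_join p p' P -> uniq P -> {subset P <= U} -> ~~ has (mem s) P ->
  heavy_join u p -> heavy_join p' w -> A != [::].
Proof.
case: A => // cyc ps Pc uP PU Ps up pw; exfalso.
have P0 : P != [::] by case: P Pc {uP PU Ps}.
apply: (no_extension ps P0 uP PU Ps (c := u :: P ++ w :: B)); first by perm_solve.
case/cycle_chain: cyc => /= /and3P[_ /andP[_ pB] _] lu.
have wB : chain heavy_join w (last w B) (w :: B) by rewrite /= !eqxx pB.
exact: chain_cycle (chain_cons (chain_cat Pc wB pw) up) lu.
Qed.

Definition two_connected_on :=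
  3 <= #|U| /\ forall v x y, v \in U -> x \in U -> y \in U -> x != v -> y != v ->
    connect (fun a b => [&& e a b, a \in U, b \in U, a != v & b != v]) x y.

Lemma connect_hit (r : rel T) (W : pred T) x c : connect r x c -> ~~ W x -> W c ->
  exists y u, [/\ connect (fun a b => [&& r a b, ~~ W a & ~~ W b]) x y, ~~ W y, W u & r y u].
Proof.
move=> /connectP[p pp ->]; elim: p x pp => [|z p IHp] x /=; first by move=> _ /negP.
case/andP => xz pp Wx Wl; have [Wz|Wz] := boolP (W z).
  by exists x, z; rewrite connect0.
have [y [u [zy Wy Wu yu]]] := IHp z pp Wz Wl.
exists y, u; split=> //; apply: connect_trans zy; apply: connect1.
by rewrite xz Wx Wz.
Qed.

(** By 2-connectedness the outside component of [x0] is attached at distinct [u1] and [u2]. If the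
    cycle neighbours of one of them are not both heavy, its adjacency spreads over the component and
    some outside vertex is attached at both. Otherwise the successors of [u1] and [u2] are joined,
    and a path through the component can be inserted. *)
Lemma spanning : cycle e s -> 3 <= size s -> two_connected_on -> {subset U <= s}.
Proof.
move=> cyc s3 [_ conn] x0 x0U; apply: contraT => x0s.
pose rO := fun y z => [&& e y z, y \in U :\: [set t in s] & z \in U :\: [set t in s]].
have rO_sym : symmetric rO by move=> y z; rewrite /rO sym andbA andbAC -andbA.
have hit v : v \in s -> exists y u, [/\ connect rO x0 y, y \in U, y \notin s, u \in s & e y u /\ u != v].
  move=> vs; have [c cs cv] : exists2 c, c \in s & c != v.
    case: s s3 us {vs} => [|c [|d t]] //= _ /andP[]; rewrite inE negb_or => /andP[cd _ _].
    have [cv|] := eqVneq c v; last by exists c; rewrite ?mem_head.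
    by exists d; rewrite ?inE ?eqxx ?orbT // -cv eq_sym.
  have x0v : x0 != v by apply: contraNneq x0s => ->.
  have := connect_hit (conn v x0 c (sU vs) x0U (sU cs) x0v cv) x0s cs.
  move=> [y [u [xy ys us' /and5P[yu yU uU _ uv]]]].
  exists y, u; split=> //; apply: connect_sub xy => a b /andP[/and5P[ab aU bU _ _] /andP[aS bS]].
  by apply: connect1; rewrite /rO ab !inE aS bS aU bU.
have [v vs] : exists v, v \in s by case: s s3 => // v ? _; exists v; rewrite mem_head.
have [x1 [u1 [c1 x1U x1s u1s [x1u1 _]]]] := hit v vs.
have [x2 [u2 [c2 x2U x2s u2s [x2u2 u21]]]] := hit u1 u1s.
have c12 : connect rO x1 x2.
  by apply: connect_trans c2; rewrite (sym_connect_sym rO_sym).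
have c21 : connect rO x2 x1 by rewrite (sym_connect_sym rO_sym).
have [P [Pc uP Ps]] : exists P, [/\ chain heavy_join x1 x2 P, uniq P & {subset P <= U :\: [set t in s]}].
  case/connectP: c12 => p /shortenP[p' pp' up' _] lp'.
  exists (x1 :: p'); split=> //.
    rewrite /= eqxx lp' eqxx andbT /=; apply: sub_path pp' => a b.
    by case/and3P => ab _ _; apply: sub_heavy_join.
  move=> z; rewrite inE => /predU1P[->|]; first by rewrite !inE x1s.
  elim: p' x1 pp' {up' lp' c21 c1 x1U x1s x1u1} => //= a p' IHp' x1 /andP[/and3P[_ _ aU] pp'].
  by rewrite inE => /predU1P[->//|/(IHp' _ pp')].
have PU : {subset P <= U} by move=> z /Ps; rewrite inE => /andP[].
have Pns : ~~ has (mem s) P by apply/hasPn => z /Ps; rewrite !inE => /andP[].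
have [i s' sE] := rot_to u1s.
have u2s' : u2 \in s' by move: u2s; rewrite -(mem_rot i) sE inE (negPf u21).
case/splitPr: u2s' sE => A B sE.
have cycA : cycle e (u1 :: A ++ u2 :: B) by rewrite -sE rot_cycle.
have psA : perm_eq (u1 :: A ++ u2 :: B) s by rewrite -sE perm_rot.
have cycB : cycle e (u2 :: B ++ u1 :: A) by rewrite cycle_swap.
have psB : perm_eq (u2 :: B ++ u1 :: A) s by rewrite -(permPl (rot_cat_cons _ _ _ _)).
have u1x1 : heavy_join u1 x1 by rewrite heavy_join_sym sub_heavy_join.
have u2x2 : heavy_join u2 x2 by rewrite heavy_join_sym sub_heavy_join.
have A0 := path_arc_nonempty (sub_cycle sub_heavy_join cycA) psA Pc uP PU Pns u1x1 (sub_heavy_join x2u2).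
have B0 : B != [::].
  apply: (path_arc_nonempty (sub_cycle sub_heavy_join cycB) psB (chain_rev heavy_join_sym Pc)) => //.
  - by rewrite rev_uniq.
  - by move=> z; rewrite mem_rev; apply: PU.
  - by rewrite has_rev.
  - exact: sub_heavy_join.
have [a [a' [b [b' [Ac Bc _ _]]]]] := cycle_split A0 B0 cycA.
exfalso; have [ab'|/negPn/andP[Ha Hb']] := boolP (~~ (H a && H b')).
  have := attached_component cycA psA Ac Bc ab' c12 x1U x1s x1u1.
  by move=> x2u1; apply: no_common_attachment cycA psA x2U x2s x2u1 x2u2.
have [ba'|/negPn/andP[Hb Ha']] := boolP (~~ (H b && H a')).
  have := attached_component cycB psB Bc Ac ba' c21 x2U x2s x2u2.
  by move=> x1u2; apply: no_common_attachment cycA psA x1U x1s x1u1 x1u2.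
have := no_crossing (sub_cycle sub_heavy_join cycA) psA Pc uP PU Pns u1x1 (sub_heavy_join x2u2)
   (sub_chain sub_heavy_join Ac) (sub_chain sub_heavy_join Bc).
case/negP; rewrite /heavy_join Ha Hb /=; apply/orP; right.
have : uniq (u1 :: A ++ u2 :: B) by rewrite (perm_uniq psA).
apply: contraTneq => abE; have /andP[aA _] := chain_mem Ac; have /andP[bB _] := chain_mem Bc.
rewrite cons_uniq cat_uniq; apply/and4P => -[_ _ /hasPn/(_ b)]; rewrite inE bB orbT -abE => /(_ isT).
by rewrite /= aA.
Qed.

(** * Elimination of the added edges between heavy vertices *)

Hypothesis heavy_degrees : forall u v, u \in U -> v \in U -> H u -> H v -> u != v ->
  #|U| <= #|[set t in U | e u t]| + #|[set t in U | e v t]|.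

(* Bondy-Chvatal exchange; by maximality of [s] the ends [y] and [last y p] have
   no common neighbour outside [s]. *)
Lemma heavy_path_crossing y p : perm_eq (y :: p) s -> path heavy_join y p ->
  H y -> H (last y p) -> y != last y p ->
  exists p1 z p2, [/\ p = p1 ++ z :: p2, e y z & e (last y p) (last y p1)].
Proof.
move=> ps pp Hy Hx xy; set x := last y p in Hx xy *.
apply: crossing_split.
have yU : y \in U by apply: sU; rewrite -(perm_mem ps) mem_head.
have xU : x \in U by apply: sU; rewrite -(perm_mem ps) mem_last.
pose Z := [set t in s]; pose A := [set t in U | e y t]; pose B := [set t in U | e x t].
have disj : [disjoint A :\: Z & B :\: Z].
  apply/pred0P => z /=; apply/negP; rewrite !inE => /andP[/and3P[zs zU yz] /and3P[_ _ xz]].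
  apply: (no_extension1 ps zU zs (perm_refl _)).
  have yx : chain heavy_join y x (y :: p) by rewrite /= !eqxx pp.
  apply: (chain_cycle (chain_cons yx _)); last exact: sub_heavy_join.
  by rewrite sub_heavy_join // sym.
have SU : Z \subset U by apply/subsetP => z; rewrite inE; apply: sU.
have cardS : #|Z| = (size p).+1.
  by rewrite cardsE (card_uniqP us) -(perm_size ps).
have AB : #|A :\: Z| + #|B :\: Z| <= #|U| - #|Z|.
  rewrite -cardsDS // -cardsUI (_ : _ :&: _ = set0); last first.
    by apply/eqP; rewrite setI_eq0.
  rewrite cards0 addn0 subset_leq_card //; apply/subsetP => z.
  by rewrite !inE => /orP[]/and3P[-> ->].
have cnt v : #|[set t in U | e v t] :&: Z| = count (e v) (y :: p).
  rewrite (permP ps) -size_filter -(card_uniqP (filter_uniq _ us)).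
  apply: eq_card => z; rewrite !inE mem_filter.
  by case zs: (z \in s); rewrite ?andbF // (sU zs) andbT.
have := heavy_degrees yU xU Hy Hx xy.
rewrite -(cardsID Z [set t in U | e y t]) -(cardsID Z [set t in U | e x t]) !cnt.
have -> : count (e x) (y :: p) = count (e x) (belast y p).
  by rewrite lastI -cats1 count_cat /= irr addn0 addn0.
rewrite /= irr add0n => le; have := subset_leq_card SU; rewrite -/A -/B cardS in le AB *.
move: #|U| #|A :\: Z| #|B :\: Z| (count (e y) p) (count (e x) _) le AB ; move: (size p); clear; lia.
Qed.

(** Rotated so that the added edge [a b] closes the cycle, the rest is a path of [g]; reversing its
    tail at a crossing closes it without that edge. *)
Lemma heavy_edge_removal (g g' : rel T) a b c : symmetric g -> subrel e g ->
  subrel g g' -> subrel g' heavy_join -> H a -> H b ->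
  (forall x y, g' x y -> ~~ g x y -> (x == a) && (y == b) || (x == b) && (y == a)) ->
  3 <= size s -> cycle g' c -> perm_eq c s -> exists2 c', cycle g c' & perm_eq c' s.
Proof.
move=> gsym eg gg' g'h Ha Hb g'E s3 cyc cs.
have [cycg|/cyclePn[i [y [p [cE ng]]]]] := boolP (cycle g c); first by exists c.
have ps : perm_eq (y :: p) s by rewrite -cE perm_rot.
have uyp : uniq (y :: p) by rewrite (perm_uniq ps).
have s3' : 3 <= size (y :: p) by rewrite (perm_size ps).
move: cyc; rewrite -(rot_cycle i) cE => /cycle_chain[/and3P[_ pp _] lg'].
set x := last y p in ng lg'.
have ab := g'E _ _ lg' ng.
have [Hx Hy] : H x /\ H y by case/orP: ab => /andP[/eqP-> /eqP->].
have xy : y != x.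
  have lp : last y p \in p by case: (p) s3' => //= z q _; exact: mem_last.
  by apply: contraTneq lp => yx; rewrite -/x -yx; case/andP: uyp.
(* A second missing edge would be the same pair again, which is possible only on two vertices. *)
have gp : path g y p.
  apply: contraT => /pathPn[p1 [z [p2 [pE ng1]]]].
  move: pp; rewrite pE cat_path /= => /and3P[_ lz _]; have := g'E _ _ lz ng1 => ab1.
  have zy : z != y by apply: contraTneq uyp => <-; rewrite pE /= mem_cat mem_head orbT.
  have zx : z = x /\ last y p1 = y.
    move: ab ab1 zy xy; case/orP => /andP[/eqP-> /eqP->]; case/orP => /andP[/eqP-> /eqP->];
    by rewrite ?eqxx.
  case: zx => zx ly.
  have p10 : p1 = [::].
    case: (p1) pE ly => // t q pE' ly'; move: uyp.
    by rewrite pE' /= -{1}ly' -cat_cons mem_cat /= mem_last.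
  move: uyp s3' zx; rewrite /x pE p10 /=; case: (p2) => //= t q + _ zE.
  by rewrite zE mem_last andbF.
have [p1 [z [p2 [pE yz xl]]]] := heavy_path_crossing ps (sub_path g'h (sub_path gg' gp)) Hy Hx xy.
exists (y :: p1 ++ rev (z :: p2)); last first.
  by rewrite -(permPr ps) pE; perm_solve.
have /and3P[gp1 _ gp2] : [&& path g y p1, g (last y p1) z & path g z p2].
  by move: gp; rewrite pE cat_path.
have zx : chain g z x (z :: p2) by rewrite /= eqxx gp2 /x pE last_cat /=.
apply: (@chain_cycle _ _ y z); last by rewrite gsym; apply: eg.
have y1 : chain g y (last y p1) (y :: p1) by rewrite /= !eqxx gp1.
by apply: chain_cat y1 (chain_rev gsym zx) _; rewrite gsym; apply: eg.
Qed.

(** Induction on a list [F] of added edges, starting from the list of all heavy pairs. *)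
Lemma light_closure c : 3 <= size s -> cycle heavy_join c -> perm_eq c s ->
  exists2 c', cycle e c' & perm_eq c' s.
Proof.
move=> s3.
pose gF (F : seq (T * T)) : rel T := fun x y => [|| e x y, (x, y) \in F | (y, x) \in F].
pose good (q : T * T) := [&& H q.1, H q.2 & q.1 != q.2].
have main F : all good F -> forall c, cycle (gF F) c -> perm_eq c s ->
    exists2 c', cycle e c' & perm_eq c' s.
  elim: F => [_ c0 cyc cs|[a b] F IHF /andP[/and3P[/= Ha Hb ab] gF1] c0 cyc cs].
    by exists c0 => //; apply: sub_cycle cyc => x y; rewrite /gF /= !orbF.
  have gFh F' : all good F' -> subrel (gF F') heavy_join.
    move=> gF' x y /or3P[|xyF|xyF]; first exact: sub_heavy_join.
      by rewrite /heavy_join; have /allP/(_ _ xyF) := gF'; rewrite /good /= => ->; rewrite orbT.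
    rewrite heavy_join_sym /heavy_join; have /allP/(_ _ xyF) := gF'.
    by rewrite /good /= => ->; rewrite orbT.
  have [|||||c' cyc' cs'] := @heavy_edge_removal (gF F) (gF ((a, b) :: F)) a b c0 _ _ _ _ Ha Hb _ s3 cyc cs.
  - by move=> x y; rewrite /gF sym; congr orb; rewrite orbC.
  - by move=> x y; rewrite /gF => ->.
  - by move=> x y; rewrite /gF !inE => /or3P[]->; rewrite ?orbT.
  - by apply: gFh; rewrite /= /good Ha Hb ab.
  - move=> x y; rewrite /gF !inE !negb_or => g'xy /and3P[/negPf nxy /negPf n1 /negPf n2].
    by move: g'xy; rewrite nxy n1 n2 !orbF /= !xpair_eqE [(y == a) && _]andbC.
  by apply: IHF cyc' cs'.
move=> cyc cs; have gF1 := filter_all good (enum {: T * T}).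
apply: (main _ gF1 c _ cs).
apply: sub_cycle cyc => x y; rewrite /gF /heavy_join !(mem_filter good) !mem_enum !inE !andbT.
by case/orP => [->//|xy]; rewrite /good xy orbT.
Qed.

End Extension.

(** * An initial cycle, and Hamilton cycles of induced subgraphs *)

Lemma neighbour_off h z : two_connected_on -> h \in U -> z \in U -> h != z ->
  exists w, [/\ w \in U, e h w & w != z].
Proof.
move=> [U3 conn] hU zU hz.
have [t tU] : exists2 t, t \in U & t \notin [set h; z].
  apply/subsetPn; apply: contraL U3 => /subset_leq_card.
  by rewrite cards2; lia.
rewrite !inE negb_or => /andP[th tz].
have /connectP[[|w p] /= pp tE] := conn z h t zU hU tU hz tz.
  by rewrite tE eqxx in th.
by case/andP: pp => /and5P[hw _ wU _ wz] _; exists w.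
Qed.

Lemma heavy_pair : two_connected_on -> #|[set h in U | H h]| < 3 ->
  exists h1 h2, [/\ h1 \in U, h2 \in U, h1 != h2, heavy_join h1 h2 &
    [set h in U | H h] \subset [set h1; h2]].
Proof.
move=> tc; have [U3 conn] := tc.
have nbr h : h \in U -> exists w, [/\ w \in U, e h w & w != h].
  move=> hU; have [z zU zh] : exists2 z, z \in U & z \notin [set h].
    apply/subsetPn; apply: contraL U3 => /subset_leq_card.
    by rewrite cards1; lia.
  rewrite inE eq_sym in zh; have [w [wU hw _]] := neighbour_off tc hU zU zh.
  by exists w; split=> //; apply: contraTneq hw => ->; rewrite irr.
case cE: #|_| => [|[|[|//]]] _.
- have /card_gt0P[h hU] : 0 < #|U| by lia.
  have [w [wU hw wh]] := nbr h hU; exists h, w; split; rewrite // 1?eq_sym // ?sub_heavy_join //.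
  by rewrite (cards0_eq cE) sub0set.
- have /cards1P[h hE] : #|[set h in U | H h]| == 1 by rewrite cE.
  have hU : h \in U by have := set11 h; rewrite -hE inE => /andP[].
  have [w [wU hw wh]] := nbr h hU; exists h, w; split; rewrite // 1?eq_sym // ?sub_heavy_join //.
  by rewrite hE sub1set !inE eqxx.
have /cards2P[h1 [h2 [h12 hE]]] : #|[set h in U | H h]| == 2 by rewrite cE.
have : h1 \in [set h1; h2] by rewrite !inE eqxx.
have : h2 \in [set h1; h2] by rewrite !inE eqxx orbT.
rewrite -hE !inE => /andP[h2U Hh2] /andP[h1U Hh1].
by exists h1, h2; split; rewrite // ?hE // /heavy_join Hh1 Hh2 h12 orbT.
Qed.

(** Three heavy vertices or more form a clique of the joined graph. Otherwise an edge [h1 h2]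
    covering the heavy ones is closed by a path that avoids [h1] and leads from another neighbour
    [w] of [h1] to [h2]. *)
Lemma initial_cycle : two_connected_on -> exists s, [/\ uniq s, 3 <= size s,
  cycle heavy_join s, {subset s <= U} & {subset [set h in U | H h] <= s}].
Proof.
move=> tc; have [_ conn] := tc.
have [H3|/(heavy_pair tc)[h1 [h2 [h1U h2U h12 hh /subsetP HU]]]] := leqP 3 #|[set h in U | H h]|.
  exists (enum [set h in U | H h]); split.
  - exact: enum_uniq.
  - by rewrite -cardE.
  - apply: uniq_cycle_clique; rewrite -?cardE ?enum_uniq ?(ltnW H3) //.
    move=> x y; rewrite !mem_enum !inE => /andP[_ Hx] /andP[_ Hy] xy.
    by rewrite /heavy_join Hx Hy xy orbT.
  - by move=> z; rewrite mem_enum inE => /andP[].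
  - by move=> z; rewrite mem_enum.
have [w [wU h1w wh2]] := neighbour_off tc h1U h2U h12.
have wh1 : w != h1 by apply: contraTneq h1w => ->; rewrite irr.
have h21 : h2 != h1 by rewrite eq_sym.
have /connectP[q qp qE] := conn h1 w h2 h1U wU h2U wh1 h21.
case/shortenP: qp qE => p pp up _ pE.
exists (h1 :: w :: p).
have pU : all (fun z => (z \in U) && (z != h1)) p.
  elim: p w pp {up pE wU h1w wh2 wh1} => //= z p IHp w /andP[/and5P[_ _ -> _ ->] /IHp ->].
  by [].
split.
- rewrite cons_uniq up andbT inE negb_or eq_sym wh1 /=.
  by apply/negP => /(allP pU); rewrite eqxx andbF.
- by case: p pE {pp up pU} => //= h2w; rewrite h2w eqxx in wh2.
- apply: (@chain_cycle _ _ h1 h2); last by rewrite heavy_join_sym.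
  apply: chain_cons (sub_heavy_join h1w); rewrite /= eqxx -pE eqxx andbT /=.
  by apply: sub_path pp => a b /andP[ab _]; apply: sub_heavy_join.
- by move=> z; rewrite !inE => /or3P[/eqP->|/eqP->|/(allP pU)/andP[]].
- move=> z /HU; rewrite !inE => /orP[]/eqP->; first by rewrite eqxx.
  by rewrite pE -in_cons mem_last orbT.
Qed.

(** Stated for a vertex set [U] because it is applied to the whole graph and to the graph without
    one or two vertices, with heaviness still measured in the whole graph. *)
Theorem hamiltonian_on : two_connected_on ->
  (forall u v, u \in U -> v \in U -> H u -> H v -> u != v ->
    #|U| <= #|[set t in U | e u t]| + #|[set t in U | e v t]|) ->
  exists s, [/\ uniq s, s =i U & cycle e s].
Proof.
move=> tc deg; have [s0 [us0 s03 cyc0 s0U Hs0]] := initial_cycle tc.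
(* A boolean predicate on lengths, so that a longest cycle can be chosen. *)
pose good (n : nat) := [exists t : n.-tuple T, [&& uniq t, 3 <= size t, cycle heavy_join t,
  all (mem U) t & [forall h in [set h in U | H h], h \in t]]].
have goodP s : uniq s -> 3 <= size s -> cycle heavy_join s -> {subset s <= U} ->
    {subset [set h in U | H h] <= s} -> good (size s).
  move=> us s3 cyc sU Hs; apply/existsP; exists (in_tuple s).
  rewrite /= us s3 cyc /=; apply/andP; split; first exact/allP.
  by apply/forall_inP.
have good_bound n : good n -> n <= #|T|.
  by case/existsP => t /and5P[ut _ _ _ _]; rewrite -(size_tuple t) -(card_uniqP ut) max_card.
have [n /existsP[t /and5P[ut t3 cyct /allP tU /forall_inP Ht]] n_max] :=
  ex_maxnP (ex_intro good _ (goodP _ us0 s03 cyc0 s0U Hs0)) good_bound.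
have Ht' h : h \in U -> H h -> h \in (t : seq T) by move=> hU Hh; apply: Ht; rewrite inE hU.
have t_max s' : uniq s' -> cycle heavy_join s' -> {subset s' <= U} -> {subset t <= s'} ->
    size s' <= size t.
  move=> us' cyc' s'U ts'; rewrite (size_tuple t); apply/n_max/goodP => //.
    by apply: leq_trans t3 (uniq_leq_size ut ts').
  by move=> h hU; apply/ts'/Ht.
have [c cyc ct] := light_closure ut tU t_max deg t3 cyct (perm_refl t).
have uc : uniq c by rewrite (perm_uniq ct).
have cU : {subset c <= U} by move=> z; rewrite (perm_mem ct); apply: tU.
exists c; split=> // z; apply/idP/idP => [|zU]; first exact: cU.
apply: (spanning uc cU _ _ cyc) zU => //.
- by move=> h hU Hh; rewrite (perm_mem ct); apply: Ht'.
- move=> s' us' cyc' s'U cs'; rewrite (perm_size ct); apply: t_max => // y.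
  by rewrite -(perm_mem ct); apply: cs'.
by rewrite (perm_size ct).
Qed.

End Hamiltonicity.

(** * Cycles indexed by natural numbers *)

Definition has_cycle (T : eqType) (e : rel T) k :=
  exists s : seq T, [/\ size s = k, uniq s & cycle e s].

(** The list [a, ..., b], empty when [b < a]. *)
Definition up a b := iota a (b.+1 - a).

Lemma mem_up i a b : (i \in up a b) = (a <= i <= b).
Proof. by rewrite mem_iota; lia. Qed.

Lemma size_up a b : size (up a b) = b.+1 - a.
Proof. exact: size_iota. Qed.

Lemma uniq_up a b : uniq (up a b).
Proof. exact: iota_uniq. Qed.

Lemma uniq_catI (T : eqType) (s t : seq T) :
  uniq s -> uniq t -> (forall i, i \in s -> i \in t -> False) -> uniq (s ++ t).
Proof.
move=> us ut st; rewrite cat_uniq us ut andbT /=; apply/hasPn => i it.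
by apply/negP => /= /st; apply.
Qed.

Lemma uniq_consI (T : eqType) x (t : seq T) :
  (x \in t -> False) -> uniq t -> uniq (x :: t).
Proof. by move=> xt ut /=; rewrite ut andbT; apply/negP. Qed.

Lemma chain_up (g : rel nat) a b : a <= b ->
  (forall i, a <= i < b -> g i i.+1) -> chain g a b (up a b).
Proof.
move=> /subnKC <-; rewrite /up -addnS addKn; move: (b - a) => {b} d.
elim: d a => [|d IHd] a gi; first by rewrite addn0 /= !eqxx.
apply: (@chain_cons _ _ a a.+1); last by apply: gi; lia.
by rewrite -addSnnS; apply: IHd => i ai; apply: gi; lia.
Qed.

Ltac uniq_nat := nat_only; repeat first [apply: uniq_catI | apply: uniq_consI | rewrite rev_uniq
  | exact: uniq_up | exact: isT];
  try (by move=> ?; rewrite !(inE, mem_cat, mem_rev, mem_up); lia);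
  try (by rewrite !(inE, mem_cat, mem_rev, mem_up); lia).

Lemma size_nilE (T : Type) : size (@nil T) = 0. Proof. by []. Qed.

Lemma size_consE (T : Type) (x : T) s : size (x :: s) = (size s).+1. Proof. by []. Qed.

Ltac size_nat := nat_only; rewrite ?(size_cat, size_rev, size_up, size_consE, size_nilE); lia.

Ltac mem_nat := nat_only; apply/allP => ?; rewrite !(inE, mem_cat, mem_rev, mem_up); lia.

Section Index.
Variables (T : finType) (e : rel T) (v : nat -> T).

Lemma index_seq (a b : nat) (L : seq nat) : chain (relpre v e) a b L -> e (v b) (v a) ->
  uniq L -> {in L &, injective v} -> uniq (map v L) /\ cycle e (map v L).
Proof.
move=> Lc ba uL vL; split; first by rewrite map_inj_in_uniq.
case: L Lc {uL vL} => // c L /and3P[/eqP-> pL /eqP lL].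
by rewrite /= rcons_path last_map lL ba andbT path_map.
Qed.

(** Cycles are given as lists of indices, which turns distinctness and length into arithmetic. *)
Lemma index_cycle (a b k : nat) (L : seq nat) : chain (relpre v e) a b L -> e (v b) (v a) ->
  uniq L -> {in L &, injective v} -> size L = k -> has_cycle e k.
Proof.
by move=> Lc ba uL vL <-; exists (map v L); have [] := index_seq Lc ba uL vL; rewrite size_map.
Qed.

Lemma index_cycle1 w (a b k : nat) (L : seq nat) : chain (relpre v e) a b L -> e (v b) w -> e w (v a) ->
  uniq L -> {in L &, injective v} -> (forall i, i \in L -> v i != w) ->
  (size L).+1 = k -> has_cycle e k.
Proof.
move=> Lc bw wa uL vL wL <-; exists (w :: map v L); split; rewrite /= ?size_map ?map_inj_in_uniq //.
  rewrite uL andbT; apply/mapP => -[i /wL /[swap] ->]; by rewrite eqxx.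
case: L Lc {uL vL wL} => // c L /and3P[/eqP-> pL /eqP lL].
by rewrite /= wa rcons_path last_map lL bw andbT path_map.
Qed.

End Index.

Section Periodic.
Variables (T : finType) (e : rel T).

(* A cycle of length [k], read as a [k]-periodic function on [nat]. *)
Definition periodic_cycle (v : nat -> T) k :=
  (forall i, e (v i) (v i.+1)) /\ (forall i j, (v i == v j) = (i == j %[mod k])).

Lemma periodic_of_seq s k : 0 < k -> size s = k -> uniq s -> cycle e s ->
  exists v, [/\ periodic_cycle v k, forall t, (t \in s) = [exists i : 'I_k, v i == t]
    & forall i, v i.+1 = next s (v i)].
Proof.
move=> k0 sk us cs; have [x0 _] : exists x0, x0 \in s.
  by case: (s) sk => [sk|x s1 _]; [rewrite -sk in k0 | exists x; rewrite mem_head].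
have vs i : nth x0 s (i %% k) \in s by rewrite mem_nth // sk ltn_mod.
have vnext i : nth x0 s (i.+1 %% k) = next s (nth x0 s (i %% k)).
  rewrite next_nth vs; case: s sk us vs {cs} => [|x p] sk us vs; first by rewrite -sk in k0.
  rewrite index_uniq ?sk ?ltn_mod // -sk /=.
  have := ltn_pmod i (ltn0Sn (size p)).
  rewrite -(addn1 i) -modnDml addn1; move: (i %% _) => r rp.
  have [->|ne] := eqVneq r (size p); first by rewrite modnn [RHS]nth_default.
  have rp' : r < size p by lia.
  by rewrite modn_small //=; apply: set_nth_default.
exists (fun i => nth x0 s (i %% k)); split=> //.
  split=> [i|i j]; last by rewrite nth_uniq // sk ltn_mod.
  by rewrite vnext; apply: next_cycle cs (vs i).
move=> t; apply/idP/existsP => [ts|[i /eqP<-]]; last exact: vs.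
have it : index t s < k by rewrite -sk index_mem.
by exists (Ordinal it); rewrite /= modn_small // nth_index.
Qed.

Variables (v : nat -> T) (k : nat).
Hypothesis vc : periodic_cycle v k.

Lemma periodic_rot l : periodic_cycle (fun i => v (l + i)) k.
Proof.
by case: vc => ve vk; split=> [i|i j]; rewrite ?addnS // vk eqn_modDl.
Qed.

Lemma periodic_inj (L : seq nat) : all (fun i => i < k) L -> {in L &, injective v}.
Proof.
case: vc => _ vk /allP Lk i j /Lk ik /Lk jk /eqP; rewrite vk => /eqP.
by rewrite !modn_small.
Qed.

Lemma periodic_neq i j : i < j < i + k -> v i != v j.
Proof.
case: vc => _ vk ij; rewrite vk; apply/negP => /eqP.
have -> : j = i + (j - i) by idx.
by rewrite -{1}[i]addn0 => /eqP; rewrite eqn_modDl mod0n modn_small; idx.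
Qed.

Lemma periodic_inj_up a b : b < a + k -> {in up a b &, injective v}.
Proof.
move=> bak i j; rewrite !mem_up => ia ja vij; apply/eqP.
case: ltngtP => // ij; [have ne : v i != v j | have ne : v j != v i];
  by [apply: periodic_neq; idx | rewrite vij eqxx in ne].
Qed.

Lemma periodic_add i : v (i + k) = v i.
Proof. by case: vc => _ vk; apply/eqP; rewrite vk modnDr. Qed.

Lemma periodic_chain a b : a <= b -> chain (relpre v e) a b (up a b).
Proof. by move=> ab; apply: chain_up => // i _; case: vc => /(_ i). Qed.

End Periodic.

(** * Graphs without heavy vertices *)

Section Shortening.
Variables (T : finType) (e : rel T).
Hypotheses (sym : symmetric e) (irr : irreflexive e).
Hypotheses (clawF : claw_heavy e (fun _ => false)) (z2F : z2_heavy e (fun _ => false)).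

(** For [d = 2] the chord skips [v 1]. For larger [d], claws at [v 0] and [v d] yield two further
    chords, an induced Z_2 excludes [d >= 4], and for [d = 3] a rerouting omits [v 2] or [v 1]. *)
Lemma shorten_chordal v k d : periodic_cycle e v k -> 2 <= d <= k - 2 -> e (v 0) (v d) ->
  (forall i d', 2 <= d' <= k - 2 -> e (v i) (v (i + d')) -> d <= d') ->
  has_cycle e k.-1.
Proof.
move=> vc dk e0d dmin; have [ve vk] := vc.
have no i j : i + 2 <= j -> j < i + d -> e (v i) (v j) = false.
  move=> ij jd; apply/negP => eij; have := dmin i (j - i).
  by rewrite subnKC; [move=> /(_ _ eij); idx | idx].
have no' i j : i + k < j + d -> j <= i + k - 2 -> i <= j -> 2 < d -> e (v i) (v j) = false.
  move=> ij jd ilj d2; rewrite -(periodic_add vc i) sym no //; idx.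
have vkk : v k = v 0 by rewrite -(periodic_add vc 0).
have ek0 : e (v k.-1) (v 0) by have := ve k.-1; rewrite prednK ?vkk //; idx.
have [d2|d3] := leqP d 2.
  have dE : d = 2 by idx.
  apply: (@index_cycle _ e v 0 k.-1 k.-1 (0 :: up 2 k.-1)).
  - by apply: (chain_cons (b := 2)); [apply: (periodic_chain vc); idx | rewrite /= -dE].
  - exact: ek0.
  - by uniq_nat.
  - by apply: (periodic_inj vc); mem_nat.
  - by size_nat.
have n1 : e (v k.-1) (v 1) = false by rewrite sym; apply: no'; idx.
have n2 : e (v 1) (v d) = false by apply: no; idx.
have neq i j : i < j < i + k -> v i != v j by apply: (periodic_neq vc).
have ekd : e (v k.-1) (v d).
  have := clawF (_ : e (v 0) (v k.-1)) (ve 0) e0d.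
  rewrite n1 n2 orbF; apply => //; first by rewrite sym.
  - by rewrite eq_sym; apply: neq; idx.
  - by apply: neq; idx.
  - by rewrite eq_sym; apply: neq; idx.
(* By minimality, the chord from [v d] to [v k.-1] spans at least [d] steps. *)
have kd : d.*2 < k.
  have kdd : d <= k - d.
    by apply: (dmin d); [idx | rewrite subnKC ?vkk 1?sym //; idx].
  have := dmin d (k.-1 - d).
  rewrite subnKC 1?sym ?ekd; last by idx.
  by move=> /(_ _ isT); idx.
have ed' : e (v d.-1) (v d) by have := ve d.-1; rewrite prednK //; idx.
have ed0 : e (v d.+1) (v 0).
  have := clawF (_ : e (v d) (v d.-1)) (ve d) (_ : e (v d) (v 0)).
  rewrite ![e (v d) _]sym ed' [e (v 0) (v d)]e0d.
  rewrite (no d.-1 d.+1) ?(sym (v d.-1) (v 0)) ?(no 0 d.-1) /=; try idx.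
  apply => //; first by apply: neq; idx.
  - by apply: neq; idx.
  - by apply: neq; idx.
(* Triangle [v 0], [v d.+1], [v d] with tail [v d.-1], [v d.-2]; for [d = 3] the tail ends in [v 1],
   a neighbour of [v 0]. *)
have [d4|d4] := leqP 4 d.
  have f1 : e (v 0) (v d.-1) = false by apply: no; idx.
  have f2 : e (v d.+1) (v d.-1) = false by rewrite sym; apply: no; idx.
  have f3 : e (v 0) (v d.-2) = false by apply: no; idx.
  have f4 : e (v d.+1) (v d.-2) = false by rewrite sym; apply: no; idx.
  have f5 : e (v d) (v d.-2) = false by rewrite sym; apply: no; idx.
  have g2 : e (v d.-1) (v d.-2).
    by have := ve d.-2; rewrite sym (_ : d.-2.+1 = d.-1) //; idx.
  have g0 : e (v 0) (v d.+1) by rewrite sym.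
  have gd : e (v d.+1) (v d) by rewrite sym.
  have gd' : e (v d) (v d.-1) by rewrite sym.
  have := z2F g0 e0d gd gd' g2 (negbT f1) (negbT f2) isT isT.
  by rewrite f3 f4 f5.
have dE : d = 3 by idx.
subst d.
have e14 : e (v 1) (v 4) \/ e (v k.-1) (v 4).
  have e0k : e (v 0) (v k.-1) by rewrite sym.
  have e04 : e (v 0) (v 4) by rewrite sym.
  have n1k : v k.-1 != v 1 by rewrite eq_sym; apply: neq; idx.
  have n4k : v 4 != v k.-1 by apply: neq; idx.
  have n41 : v 4 != v 1 by rewrite eq_sym; apply: neq; idx.
  by have /orP[] := clawF e0k (ve 0) e04 n1k n4k n41 isT isT (negbT n1); [right|left].
have ch4 : chain (relpre v e) 4 (k - 2) (up 4 (k - 2)) by apply: (periodic_chain vc); idx.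
have ek2 : e (v (k - 2)) (v k.-1) by have := ve (k - 2); rewrite (_ : (k - 2).+1 = k.-1) //; idx.
have injk L : all (fun i => i < k) L -> {in L &, injective v} by apply: (periodic_inj vc).
have [e14'|e14'] := boolP (e (v 1) (v 4)).
  apply: (@index_cycle _ e v k.-1 (k - 2) k.-1 ([:: k.-1; 3; 0; 1] ++ up 4 (k - 2))) => //.
  - apply: chain_cat ch4 _; last exact: e14'.
    by rewrite /= eqxx ekd sym e0d (ve 0).
  - by uniq_nat.
  - by apply: injk; mem_nat.
  - by size_nat.
have ek4 : e (v k.-1) (v 4) by case: e14 => //; rewrite (negPf e14').
(* Triangle [v k.-1], [v 4], [v 0] with tail [v 1], [v 2]. *)
have e2 : e (v k.-1) (v 2).
  have n41 : e (v 4) (v 1) = false by rewrite sym (negPf e14').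
  have n42 : e (v 4) (v 2) = false by rewrite sym; apply: no; idx.
  have n02 : e (v 0) (v 2) = false by apply: no; idx.
  by have := z2F ek4 ek0 ed0 (ve 0) (ve 1) (negbT n1) (negbT n41) isT isT; rewrite n42 n02 !orbF.
apply: (@index_cycle _ e v k.-1 (k - 2) k.-1 ([:: k.-1; 2; 3; 0] ++ up 4 (k - 2))) => //.
- apply: (chain_cat (b := 0)) ch4 _; last by rewrite /= sym.
  by rewrite /= eqxx e2 (ve 2) [e (v 3) _]sym e0d.
- by uniq_nat.
- by apply: injk; mem_nat.
- by size_nat.
Qed.

(** A claw at the attachment gives [w] two consecutive neighbours, renamed [v 0] and [v 1]. Tails of
    Z_2 along both directions of the cycle then provide two neighbours of [w] that bound an arc of
    [k - 2] vertices, which [w] closes. *)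
Lemma shorten_chordless v k w i : periodic_cycle e v k -> 4 <= k ->
  (forall i d', 2 <= d' <= k - 2 -> e (v i) (v (i + d')) = false) ->
  (forall i, v i != w) -> e w (v i) -> has_cycle e k.-1.
Proof.
wlog: v i / i = 0 /\ e w (v 1).
  move=> IH vc k4 nc vw wi.
  have vc0 := periodic_rot vc i.
  have step l : e w (v (i + l)) -> e w (v (i + l).+1) -> has_cycle e k.-1.
    move=> w0 w1; apply: (IH (fun j => v (i + l + j)) 0) => //.
    - by rewrite addn1.
    - exact: periodic_rot.
    - by move=> j d' dk; rewrite addnA nc.
    - by rewrite addn0.
  have [w1|w1] := boolP (e w (v i.+1)); first by apply: (step 0); rewrite addn0.
  apply: (step k.-1); last first.
    by rewrite -addnS prednK ?(periodic_add vc) //; idx.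
  have ei : e (v i) (v (i + k.-1)).
    have [ve _] := vc; rewrite sym; have := ve (i + k.-1).
    by rewrite -addnS prednK ?(periodic_add vc) //; idx.
  have eiw : e (v i) w by rewrite sym.
  have far : e (v i.+1) (v (i + k.-1)) = false.
    by rewrite (_ : i + k.-1 = i.+1 + (k - 2)) ?nc //; idx.
  have neq : v (i + k.-1) != v i.+1 by rewrite eq_sym; apply: (periodic_neq vc); idx.
  have w1' : ~~ e (v i.+1) w by rewrite sym.
  by have := clawF (vc.1 i) eiw ei (vw _) neq (vw _) isT isT w1'; rewrite far.
move=> [-> w1] vc k4 nc vw w0; have [ve vk] := vc.
have vkk : v k = v 0 by rewrite -(periodic_add vc 0).
have ek0 : e (v k.-1) (v 0) by have := ve k.-1; rewrite prednK ?vkk //; idx.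
have injk L : all (fun i => i < k) L -> {in L &, injective v} by apply: (periodic_inj vc).
have cyc a b : e w (v a) -> e w (v b) -> a <= b < k -> b - a = k - 3 -> has_cycle e k.-1.
  move=> wa wb ab bak; apply: (@index_cycle1 _ e v w a b k.-1 (up a b)) => //.
  - by apply: (periodic_chain vc); idx.
  - by rewrite sym.
  - exact: uniq_up.
  - by apply: injk; mem_nat.
  - by size_nat.
have [k5|k5] := leqP k 4; first by apply: (cyc 0 1) => //; idx.
have n d' i' : 2 <= d' <= k - 2 -> e (v i') (v (i' + d')) = false by apply: nc.
have [w3|w3] := boolP (e w (v 3)).
  apply: (@index_cycle1 _ e v w 3 k k.-1 (up 3 k)) => //.
  - by apply: (periodic_chain vc); idx.
  - by rewrite vkk sym.
  - exact: uniq_up.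
  - by apply: (periodic_inj_up vc); idx.
  - by size_nat.
have w2 : e w (v 2).
  have n03' : e (v 0) (v 3) = false by apply: (n 3 0); idx.
  have n02' : e (v 0) (v 2) = false by apply: (n 2 0); idx.
  have n13' : e (v 1) (v 3) = false by apply: (n 2 1); idx.
  apply: contraT => w2.
  by have := z2F w0 w1 (ve 0) (ve 1) (ve 2) w2 (negbT n02') isT isT; rewrite (negPf w3) n03' n13'.
have e10 : e (v 1) (v 0) by rewrite sym.
have e0k : e (v 0) (v k.-1) by rewrite sym.
have ekk : e (v k.-1) (v (k - 2)).
  by have := ve (k - 2); rewrite sym (_ : (k - 2).+1 = k.-1) //; idx.
have n1k : e (v 1) (v k.-1) = false.
  by rewrite (_ : k.-1 = 1 + (k - 2)) ?n //; idx.
have n1k' : e (v 1) (v (k - 2)) = false.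
  by rewrite (_ : k - 2 = 1 + (k - 3)) ?n //; idx.
have n0k' : e (v 0) (v (k - 2)) = false by apply: (n (k - 2) 0); idx.
have [wk|wk] := boolP (e w (v k.-1)); first by apply: (cyc 2 k.-1) => //; idx.
have := z2F w1 w0 e10 e0k ekk wk (negbT n1k) isT isT; rewrite n1k' n0k' !orbF => wk'.
by apply: (cyc 1 (k - 2)) => //; idx.
Qed.

(** A chordless spanning cycle would be the whole graph; a chordless cycle that misses a vertex has
    some vertex attached to it by connectedness. *)
Lemma shorten_cycle k : 4 <= k -> has_cycle e k -> connected_graph e -> ~ is_cycle_graph e ->
  has_cycle e k.-1.
Proof.
move=> k4 [s [sk us cs]] conn ncyc.
have k0 : 0 < k by lia.
have [v [vc vs vnext]] := periodic_of_seq k0 sk us cs.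
pose P d := (2 <= d <= k - 2) && [exists i : 'I_k, e (v i) (v (i + d))].
have PP i d : 2 <= d <= k - 2 -> e (v i) (v (i + d)) -> P d.
  move=> dk eid; rewrite /P dk; apply/existsP; exists (Ordinal (ltn_pmod i k0)) => /=.
  have -> : v (i %% k) = v i by apply/eqP; rewrite vc.2 modn_mod.
  by have -> : v (i %% k + d) = v (i + d) by apply/eqP; rewrite vc.2 modnDml.
have [/existsP[d Pd]|nP] := boolP [exists d : 'I_k, P d].
  have [m /andP[mk /existsP[i eim]] mmin] := ex_minnP (ex_intro P _ Pd).
  apply: (shorten_chordal (periodic_rot vc i) mk); first by rewrite addn0.
  move=> j d' dk; rewrite addnA => ejd; apply: mmin; apply: PP dk ejd.
have nc i d' : 2 <= d' <= k - 2 -> e (v i) (v (i + d')) = false.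
  move=> dk; apply: contraNF nP => eid; apply/existsP.
  have d'k : d' < k by lia.
  by exists (Ordinal d'k); apply: PP eid.
have [/subsetP sT|/subsetPn[w _ ws]] := boolP (setT \subset s).
  case: ncyc; exists s; split=> //.
  - by rewrite -(card_uniqP us); apply: eq_card => z; rewrite sT ?inE.
  - have <- : size s = #|T| by rewrite -(card_uniqP us); apply: eq_card => z; rewrite sT ?inE.
    by rewrite sk; lia.
  move=> x y; apply/idP/orP => [exy|[/eqP->|/eqP->]]; last 2 first.
  - by rewrite next_cycle ?sT ?inE.
  - by rewrite sym next_cycle ?sT ?inE.
  have : x \in s by rewrite sT ?inE.
  have : y \in s by rewrite sT ?inE.
  rewrite !vs => /existsP[j /eqP jy] /existsP[i /eqP ix]; subst x y.
  rewrite -!vnext !vc.2.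
  wlog: i j exy / i <= j.
    by move=> IH; case/orP: (leq_total i j) => ij; [apply: IH | rewrite or_comm; apply: IH => //; rewrite sym].
  move=> ij; have ik := ltn_ord i; have jk := ltn_ord j.
  have [j1|j1] := eqVneq (j : nat) i.+1; first by left; rewrite j1.
  have [ij0|ij0] := eqVneq (i : nat) j; first by rewrite ij0 irr in exy.
  have [ik1|ik1] := eqVneq (j - i) k.-1.
    by right; have [-> ->] : (i : nat) = 0 /\ j.+1 = k by [split; lia]; rewrite mod0n modnn.
  have ji : 2 <= j - i <= k - 2 by idx.
  by have := nc i _ ji; rewrite subnKC // exy.
have [ve _] := vc.
have v0s : v 0 \in s by rewrite vs; apply/existsP; exists (Ordinal k0).
have [y [u [_ ys us' yu]]] := connect_hit (W := mem s) (conn w (v 0)) ws v0s.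
have : u \in s by []; rewrite vs => /existsP[i /eqP iu]; subst u.
apply: (shorten_chordless vc k4 nc _ yu) => j.
apply: contraNneq ys => <-; rewrite [mem s _]vs; apply/existsP.
exists (Ordinal (ltn_pmod j k0)); rewrite vc.2 /=; by rewrite modn_mod.
Qed.

Lemma light_pancyclic : has_cycle e #|T| -> connected_graph e -> ~ is_cycle_graph e ->
  pancyclic e.
Proof.
move=> ham conn ncyc k /andP[k3 kn].
have : has_cycle e (#|T| - (#|T| - k)).
  have : #|T| - k <= #|T| - 3 by lia.
  elim: (#|T| - k) => [|d IHd] dn; first by rewrite subn0.
  by rewrite subnS; apply: shorten_cycle => //; [lia | apply: IHd; lia].
by rewrite subKn.
Qed.

End Shortening.

(** * Graphs with a heavy vertex *)

(** Pigeonhole for [D] and the cyclic shift of [D'] by [d] within [1, ..., m]; coincidences that do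
    not wrap around and those that do are counted separately. *)
Lemma count_shift (D D' : pred nat) m d t : d <= m ->
  m + t <= count D (iota 1 m) + count D' (iota 1 m) ->
  t <= count (fun i => D i && D' (i + d)) (iota 1 (m - d)) +
       count (fun j => D (j + (m - d)) && D' j) (iota 1 d).
Proof.
move=> dm.
have mapE a b c (P : pred nat) : count P (iota (a + b) c) = count (fun i => P (i + b)) (iota a c).
  rewrite addnC iotaDl count_map; apply: eq_count => i /=; by rewrite addnC.
have -> : count D (iota 1 m) = count D (iota 1 (m - d)) + count (fun i => D (i + (m - d))) (iota 1 d).
  by rewrite -{1}(subnK dm) iotaD count_cat mapE.
have -> : count D' (iota 1 m) = count D' (iota 1 d) + count (fun i => D' (i + d)) (iota 1 (m - d)).
  by rewrite -{1}(subnKC dm) iotaD count_cat mapE.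
have UI (P Q : pred nat) c : count P (iota 1 c) + count Q (iota 1 c) <= c + count (fun i => P i && Q i) (iota 1 c).
  rewrite -count_predUI leq_add // -{2}(size_iota 1 c); exact: count_size.
have := UI D (fun i => D' (i + d)) (m - d).
have := UI (fun i => D (i + (m - d))) D' d.
lia.
Qed.

Lemma count_gt1 (P : pred nat) a c : 1 < count P (iota a c) ->
  exists i j, [/\ i < j, a <= i, j < a + c, P i & P j].
Proof.
rewrite -size_filter => s2; have := sorted_filter ltn_trans P (iota_ltn_sorted a c).
have mem i : i \in filter P (iota a c) -> [&& P i, a <= i & i < a + c].
  by rewrite mem_filter mem_iota.
case: (filter _ _) s2 mem => [|i [|j l]] //= _ mem /andP[ij _].
have /and3P[Pi ai _] := mem i (mem_head _ _).
have /and3P[Pj _ jc] : [&& P j, a <= j & j < a + c] by apply: mem; rewrite !inE eqxx orbT.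
by exists i, j.
Qed.

(* [2 d(u) > n] is [d(u) >= (n + 1) / 2]. *)
Definition heavy (T : finType) (e : rel T) (u : T) := #|T| < (deg e u).*2.

Section HeavyFan.
Variables (T : finType) (e : rel T).
Hypotheses (sym : symmetric e) (irr : irreflexive e).
Notation n := #|T|.

Lemma deg_count v u : periodic_cycle e v n -> deg e u = count (fun i => e u (v i)) (iota 0 n).
Proof.
move=> vc; have uv : uniq (map v (iota 0 n)).
  rewrite map_inj_in_uniq ?iota_uniq //; apply: (periodic_inj vc).
  by apply/allP => i; rewrite mem_iota.
rewrite /deg -(count_map v (e u)) -size_filter -(card_uniqP (filter_uniq _ uv)).
apply: eq_card => z; rewrite !inE mem_filter.
have /(_ z)-> : map v (iota 0 n) =i T; last by rewrite inE andbT.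
apply/subset_cardP; last by apply/subsetP.
by rewrite (card_uniqP uv) size_map size_iota.
Qed.

Lemma periodic_surj v t : periodic_cycle e v n -> exists2 i, i < n & v i = t.
Proof.
move=> vc; have uv : uniq (map v (iota 0 n)).
  rewrite map_inj_in_uniq ?iota_uniq //; apply: (periodic_inj vc).
  by apply/allP => i; rewrite mem_iota.
have : t \in map v (iota 0 n).
  have /(_ t)-> : map v (iota 0 n) =i T; last by [].
  apply/subset_cardP; last by apply/subsetP.
  by rewrite (card_uniqP uv) size_map size_iota.
by case/mapP => i; rewrite mem_iota => /andP[_ ik] ->; exists i.
Qed.

(** The two vertices send at least [n - 1] edges to the other [n - 2] vertices, so neighbours of
    theirs occur at cyclic distance [k - 3]. If the pair does not wrap around, its arc is closed by
    the edge between [v 0] and [v n.-1]; a wrapping pair uses the two end segments instead. *)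
Lemma heavy_consecutive v k : periodic_cycle e v n -> heavy e (v 0) -> heavy e (v n.-1) ->
  3 <= k <= n -> has_cycle e k.
Proof.
move=> vc H0 Hn kn; have [ve vk] := vc.
have vn0 : v n = v 0 by rewrite -(periodic_add vc 0).
have en0 : e (v n.-1) (v 0) by have := ve n.-1; rewrite prednK ?vn0 //; lia.
have [m nm] : exists m, n = m.+2 by exists (n - 2); lia.
have cnt u : count (fun i => e u (v i)) (iota 1 m) + e u (v 0) + e u (v n.-1) = deg e u.
  rewrite (deg_count _ vc) nm -[m.+2]addn1 iotaD count_cat /= addn0.
  by rewrite add0n addn1 [e u (v 0) + _]addnC.
have cyc L a b := @index_cycle _ e v a b k L.
have injn L : all (fun i => i < n) L -> {in L &, injective v} by apply: (periodic_inj vc).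
have e01 := ve 0; have em0 : e (v m.+1) (v 0) by rewrite nm in en0.
have km : k - 3 <= m by idx.
have : m + 1 <= count (fun i => e (v 0) (v i)) (iota 1 m) +
                count (fun i => e (v n.-1) (v i)) (iota 1 m).
  have := cnt (v 0); have := cnt (v n.-1); rewrite !irr en0 (sym (v 0)) en0.
  by move: H0 Hn; rewrite /heavy nm /=; clear; lia.
case/(count_shift km)/(leq_trans (ltn0Sn 0)); rewrite addn_gt0 -!has_count.
case/orP => /hasP[i]; rewrite mem_iota => iR /andP[e0i]; rewrite nm /= => emi.
- apply: (cyc (0 :: up i (i + (k - 3)) ++ [:: m.+1]) 0 m.+1) => //.
  + apply: (chain_cons (b := i)) => //.
    apply: (chain_cat _ (chain1 _ _)); first by apply: (periodic_chain vc); idx.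
    by rewrite /= sym.
  + by uniq_nat.
  + by apply: injn; rewrite nm; mem_nat.
  + by size_nat.
apply: (cyc (0 :: up (i + (m - (k - 3))) m.+1 ++ rev (up 1 i)) 0 1) => //.
+ apply: (chain_cons (b := i + (m - (k - 3)))) => //.
  apply: (chain_cat (b := m.+1) (c := i)) => //; first by apply: (periodic_chain vc); idx.
  apply: chain_rev; first by move=> ? ?; rewrite /= sym.
  by apply: (periodic_chain vc); idx.
+ by rewrite sym.
+ by uniq_nat.
+ by apply: injn; rewrite nm; mem_nat.
by size_nat.
Qed.

Lemma count_deg C x : uniq C -> (forall y, e x y -> y \in C) -> count (e x) C = deg e x.
Proof.
move=> uO xO; rewrite /deg -size_filter -(card_uniqP (filter_uniq _ uO)).
by apply: eq_card => z; rewrite !inE mem_filter; case xz: (e x z) => //=; apply: xO.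
Qed.

Lemma dominated C x y : uniq C -> x \notin C -> size C = n.-1 -> e x y -> y \in C.
Proof.
move=> uO xO sO xy; have uxO : uniq (x :: C) by rewrite /= xO.
have n0 : 0 < n by apply/card_gt0P; exists x.
have : y \in x :: C.
  have /(_ y)-> : x :: C =i T; last by [].
  apply/subset_cardP; last by apply/subsetP.
  by rewrite (card_uniqP uxO) /= sO prednK.
by rewrite inE => /predU1P[yx|//]; rewrite yx irr in xy.
Qed.

(** The same pigeonhole with both sets equal to the neighbours of [x]: two of them at cyclic
    distance [k - 2] bound an arc that [x] closes. *)
Lemma fan_off_cycle C x k : uniq C -> cycle e C -> x \notin C ->
  size C < (count (e x) C).*2 -> 3 <= k <= (size C).+1 -> has_cycle e k.
Proof.
move=> uO cO xO degx kO.
have O0 : 0 < size C by case: (C) degx.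
have [v [vc vO _]] := periodic_of_seq O0 (erefl _) uO cO; set m := size C in kO O0 vc degx vO *.
have cntE : count (e x) C = count (fun i => e x (v i)) (iota 1 m).
  have uv : uniq (map v (iota 1 m)).
    rewrite map_inj_in_uniq ?iota_uniq //.
    have -> : iota 1 m = up 1 m by rewrite /up subn1.
    by apply: (periodic_inj_up vc); rewrite addnC addn1.
  rewrite -(count_map v (e x)); apply/permP; apply: uniq_perm => // z.
  have vsub : {subset map v (iota 1 m) <= C}.
    move=> t /mapP[i _ ->]; rewrite vO; apply/existsP.
    by exists (Ordinal (ltn_pmod i O0)); rewrite vc.2 /= modn_mod.
  have sz : size C <= size (map v (iota 1 m)) by rewrite size_map size_iota.
  by have [_ ->] := uniq_min_size uv vsub sz.
have vx i : v i != x.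
  apply: contraNneq xO => <-; rewrite vO; apply/existsP.
  by exists (Ordinal (ltn_pmod i O0)); rewrite vc.2 /= modn_mod.
have cyc a : e x (v a) -> e x (v (a + (k - 2))) -> has_cycle e k.
  move=> xa xb; apply: (@index_cycle1 _ e v x a (a + (k - 2)) k (up a (a + (k - 2)))) => //.
  - by apply: (periodic_chain vc); lia.
  - by rewrite sym.
  - exact: uniq_up.
  - by apply: (periodic_inj_up vc); idx.
  - by size_nat.
have km : k - 2 <= m by idx.
have : m + 1 <= count (fun i => e x (v i)) (iota 1 m) + count (fun i => e x (v i)) (iota 1 m).
  by rewrite -cntE; move: degx; clear; lia.
case/(count_shift km)/(leq_trans (ltn0Sn 0)); rewrite addn_gt0 -!has_count.
case/orP => /hasP[i]; rewrite mem_iota => iR /andP[e1 e2]; first exact: cyc e1 e2.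
apply: cyc e1 _; rewrite (_ : i + (m - (k - 2)) + (k - 2) = i + m); last by idx.
by rewrite (periodic_add vc).
Qed.

(** * Consequences of a missing cycle length *)

Section Missing.
Variable k : nat.
Hypotheses (kn : 3 <= k <= n) (nok : ~ has_cycle e k).

Lemma missing_lt v : periodic_cycle e v n -> k < n.
Proof.
move=> vc; rewrite ltn_neqAle; case/andP: kn => k3 ->; rewrite andbT.
apply/eqP => kE; apply: nok; apply: (@index_cycle _ e v 0 k.-1 k (up 0 k.-1)).
- by apply: (periodic_chain vc); lia.
- have [ve _] := vc; have := ve k.-1; rewrite prednK; last by lia.
  by rewrite -(periodic_add vc 0) kE.
- exact: uniq_up.
- by apply: (periodic_inj_up vc); lia.
by size_nat.
Qed.

Lemma no_heavy_consecutive v i : periodic_cycle e v n -> heavy e (v i) -> heavy e (v i.+1) -> False.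
Proof.
move=> vc Hi Hi1; apply: nok.
apply: (heavy_consecutive (periodic_rot vc i.+1) _ _ kn); first by rewrite addn0.
by rewrite (_ : i.+1 + n.-1 = i + n) ?(periodic_add vc) //; lia.
Qed.

Lemma no_heavy_cycle_edge s x : uniq s -> size s = n -> cycle e s -> x \in s ->
  heavy e x -> heavy e (next s x) -> False.
Proof.
move=> us sn cs xs Hx Hy; have n0 : 0 < n by lia.
have [v [vc vs vnext]] := periodic_of_seq n0 sn us cs.
move: xs; rewrite vs => /existsP[i /eqP vi]; subst x.
by apply: (no_heavy_consecutive vc Hx); rewrite vnext.
Qed.

(** In particular, no cycle of length [n - 1] avoids a heavy vertex. *)
Lemma no_dominating_cycle C x : uniq C -> cycle e C -> x \notin C ->
  size C < (count (e x) C).*2 -> size C < k.-1.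
Proof.
move=> uO cO xO degx; rewrite ltnNge; apply/negP => Ok; apply: nok.
by apply: (fan_off_cycle uO cO xO degx); lia.
Qed.

Lemma no_heavy_bypass v i : periodic_cycle e v n -> heavy e (v i.+1) -> ~~ e (v i) (v i.+2).
Proof.
move=> vc Hi; apply/negP => ei.
have n3 : 3 <= n by lia.
have vin : {in up i.+2 (i + n) &, injective v} by apply: (periodic_inj_up vc); lia.
have ch : chain (relpre v e) i.+2 (i + n) (up i.+2 (i + n)) by apply: (periodic_chain vc); lia.
have ein : e (v (i + n)) (v i.+2) by rewrite (periodic_add vc).
have [uO cO] := @index_seq _ e v _ _ _ ch ein (uniq_up _ _) vin.
set C := map _ _ in uO cO.
have sO : size C = n.-1 by rewrite size_map size_up; lia.
have xO : v i.+1 \notin C.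
  apply/mapP => -[j]; rewrite mem_up => jR /eqP; apply/negP.
  by apply: (periodic_neq vc); lia.
have := no_dominating_cycle uO cO xO.
rewrite (count_deg uO) ?sO; last by move=> y; apply: (dominated uO xO sO).
by move: Hi; rewrite /heavy => Hi /(_ _); lia.
Qed.

Hypotheses (clawH : claw_heavy e (heavy e)) (z2H : z2_heavy e (heavy e)).

(** * Cut vertices of an interval of the Hamilton cycle *)

Section Interval.
Variables (v : nat -> T) (a b : nat).
Hypotheses (vc : periodic_cycle e v n) (ab : a.+2 <= b) (ban : b < a + n).
Let U := [set t in map v (up a b)].

Lemma interval_mem i : a <= i <= b -> v i \in U.
Proof. by move=> iab; rewrite inE; apply: map_f; rewrite mem_up. Qed.

Lemma card_interval : #|U| = b.+1 - a.
Proof.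
rewrite cardsE (card_uniqP _) ?size_map ?size_up //.
by rewrite map_inj_in_uniq ?uniq_up //; apply: (periodic_inj_up vc).
Qed.

(** Deleting [v s] leaves at most two segments, each of them a path; if no [s] is a cut, an edge
    joins the segments for every inner [s]. *)
Lemma cut_or_two_connected :
  (exists2 s, a < s < b & forall i j, a <= i < s -> s < j <= b -> e (v i) (v j) = false) \/
  two_connected_on e U.
Proof.
pose P s := ~~ has (fun i => has (fun j => e (v i) (v j)) (up s.+1 b)) (up a s.-1).
have [/hasP[s]|nP] := boolP (has P (up a.+1 b.-1)).
  rewrite mem_up => sR /hasPn Ps; left; exists s; first by lia.
  move=> i j iR jR; apply/negbTE; have /Ps/hasPn : i \in up a s.-1 by rewrite mem_up; lia.
  by apply; rewrite mem_up; lia.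
right; split; first by rewrite card_interval; lia.
move=> z x y; rewrite !inE => /mapP[s + zE] /mapP[i + xE] /mapP[j + yE]; rewrite !mem_up.
move=> sR iR jR xz yz; subst z x y.
pose r := fun c d => [&& e c d, c \in U, d \in U, c != v s & d != v s].
have rsym : symmetric r.
  by move=> c d; rewrite /r sym; apply/and5P/and5P => -[].
have seg c d : a <= c -> c + d <= b -> ~~ (c <= s <= c + d) -> connect r (v c) (v (c + d)).
  elim: d => [|d IHd] ac cdb nsd; first by rewrite addn0 connect0.
  apply: connect_trans (IHd ac _ _) _; [idx | by apply: contra nsd; idx |].
  apply: connect1; rewrite /r addnS; have [ve _] := vc; rewrite ve !interval_mem /=; [|idx..].
  have ne l : a <= l <= b -> l != s -> v l != v s.
    move=> lR ls; have [ls'|sl] : l < s \/ s < l by idx.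
      by apply: (periodic_neq vc); idx.
    by rewrite eq_sym; apply: (periodic_neq vc); idx.
  by rewrite !ne //; move: nsd; clear -ac cdb; lia.
have seg' c d : a <= c -> c <= d -> d <= b -> ~~ (c <= s <= d) -> connect r (v c) (v d).
  by move=> ac cd db nsd; rewrite -(subnKC cd); apply: seg; rewrite ?subnKC.
have [is' js'] : i != s /\ j != s by split; [apply: contraNneq xz => -> | apply: contraNneq yz => ->].
wlog ij : i j iR jR xz yz is' js' / i <= j.
  move=> IH; have [|/ltnW] := leqP i j; first exact: IH.
  by rewrite (sym_connect_sym rsym); apply: IH.
have [nsd|sij] := boolP (~~ (i <= s <= j)); first by apply: seg' => //; idx.
have /hasPn/(_ s) := nP; rewrite mem_up negbK => /(_ _)/hasP[|c]; first by move: sij; idx.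
rewrite mem_up => cR /hasP[d]; rewrite mem_up => dR ecd.
have sij' : i < s < j by move: sij; idx.
have ne l : a <= l <= b -> l != s -> v l != v s.
  move=> lR ls; have [ls'|sl] : l < s \/ s < l by idx.
    by apply: (periodic_neq vc); idx.
  by rewrite eq_sym; apply: (periodic_neq vc); idx.
have both l m : a <= l <= b -> a <= m <= b -> (l < s) && (m < s) || (s < l) && (s < m) -> connect r (v l) (v m).
  move=> lR mR lm; have [lem|/ltnW lem] := leqP l m; last rewrite (sym_connect_sym rsym).
    by apply: seg'; move: lm; idx.
  by apply: seg'; move: lm; idx.
apply: (connect_trans (y := v c)); first by apply: both; idx.
apply: (connect_trans (y := v d)); last by apply: both; idx.
by apply: connect1; rewrite /r ecd !interval_mem ?ne //; idx.
Qed.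

Lemma degree_interval u : deg e u <= #|[set t in U | e u t]| + #|[set t | e u t] :\: U|.
Proof.
rewrite /deg -(cardsID U [set t | e u t]) leq_add2r subset_leq_card //.
by apply/subsetP => t; rewrite !inE andbC.
Qed.

End Interval.

(** If the graph without [v 0] were 2-connected, it would have a Hamilton cycle, of length [n - 1]
    and avoiding the heavy [v 0]. *)
Lemma cut_exists v : periodic_cycle e v n -> heavy e (v 0) ->
  exists2 s, 1 < s < n.-1 & forall i j, 0 < i < s -> s < j < n -> e (v i) (v j) = false.
Proof.
move=> vc H0; have n4 : k < n := missing_lt vc.
have R1 : 3 <= n.-1 by idx.
have R2 : n.-1 < 1 + n by idx.
have [[s sR cut]|tc] := cut_or_two_connected vc R1 R2.
  by exists s => // i j iR jR; apply: cut; idx.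
set U := [set t in _] in tc.
have UE t : (t \in U) = (t != v 0).
  have [i ik <-] := periodic_surj t vc.
  have [->|i0] := posnP i.
    rewrite eqxx inE; apply/mapP => -[j]; rewrite mem_up => jR /eqP; apply/negP.
    by apply: (periodic_neq vc); idx.
  rewrite interval_mem; last by idx.
  by rewrite eq_sym (periodic_neq vc) //; idx.
have cU : #|U| = n.-1 by rewrite (card_interval vc) //; idx.
have [|C [uO CU cO]] := hamiltonian_on sym irr clawH z2H tc.
  (* Each heavy vertex loses at most the neighbour [v 0], so the degree sum stays at least
     [n + 1 - 2], the size of [U]. *)
  move=> u w _ _ Hu Hw _; rewrite cU.
  have := degree_interval v 1 n.-1 u; have := degree_interval v 1 n.-1 w; rewrite -/U.
  have D t : #|[set z | e t z] :\: U| <= 1.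
    rewrite -(cards1 (v 0)) subset_leq_card //; apply/subsetP => z.
    by rewrite in_setD UE in_set1 negbK => /andP[].
  have := D u; have := D w; move: Hu Hw; rewrite /heavy; clear; lia.
have x0 : v 0 \notin C by rewrite CU UE eqxx.
have sO : size C = n.-1 by rewrite -cU -(card_uniqP uO); apply: eq_card.
have := no_dominating_cycle uO cO x0.
rewrite (count_deg uO) ?sO; last by move=> y; apply: (dominated uO x0 sO).
by move: H0; rewrite /heavy => H0 /(_ _); lia.
Qed.

(** The degrees add up to at least [n + 1] while the union of the neighbourhoods misses [x] and [y],
    so there are at least three common neighbours. *)
Lemma heavy_common_neighbours x y a b : heavy e x -> heavy e y -> x != y -> ~~ e x y ->
  [set t | e x t] :&: [set t | e y t] \subset [set a; b] -> False.
Proof.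
move=> xH yH xy nxy I.
have D : [set t | e x t] :|: [set t | e y t] \subset ~: [set x; y].
  apply/subsetP => t; rewrite !inE negb_or => /orP[ext|eyt]; apply/andP; split.
  - by apply: contraTneq ext => ->; rewrite irr.
  - by apply: contraTneq ext => ->.
  - by apply: contraTneq eyt => ->; rewrite sym.
  - by apply: contraTneq eyt => ->; rewrite irr.
have := cardsUI [set t | e x t] [set t | e y t].
have := subset_leq_card I; have := subset_leq_card D.
have := cardsC [set x; y]; rewrite !cards2 xy.
by move: xH yH; rewrite /heavy /deg; case: (a != b); clear; lia.
Qed.

(** * Neighbours of a heavy vertex along the Hamilton cycle *)

Section Cut.
Variable v : nat -> T.
Hypotheses (vc : periodic_cycle e v n) (H0 : heavy e (v 0)).
Local Notation E i j := (e (v i) (v j)).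

Lemma missing_index_cycle (a b : nat) L : chain (relpre v e) a b L -> E b a -> uniq L ->
  all (fun i => i < n) L -> size L = k -> False.
Proof.
by move=> Lc ba uL Ln sL; apply/nok/(index_cycle Lc ba uL _ sL)/(periodic_inj vc).
Qed.

Lemma index_neq i j : i < n -> j < n -> i != j -> v i != v j.
Proof.
move=> ik jk; case: ltngtP => // ij _; first by apply: (periodic_neq vc); idx.
by rewrite eq_sym; apply: (periodic_neq vc); idx.
Qed.

Lemma edge_back i : E i.+1 i.
Proof. by rewrite sym; have [] := vc. Qed.

Lemma edge_last : E n.-1 0.
Proof.
have [ve _] := vc; have := ve n.-1; rewrite prednK; last by idx.
by rewrite -(periodic_add vc 0).
Qed.

Lemma chain_down a b : b <= a -> chain (relpre v e) a b (rev (up b a)).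
Proof.
move=> ba; apply: chain_rev; last exact: (periodic_chain vc).
by move=> ? ?; rewrite /= sym.
Qed.

Lemma no_fan j : 0 < j -> j + (k - 2) < n -> E 0 j -> E 0 (j + (k - 2)) -> False.
Proof.
move=> j0 jn e1 e2.
apply: (@missing_index_cycle 0 (j + (k - 2)) (0 :: up j (j + (k - 2)))).
- by apply: (chain_cons (b := j)) => //; apply: (periodic_chain vc); idx.
- by rewrite sym.
- by uniq_nat.
- by mem_nat.
by size_nat.
Qed.

Lemma light_succ : ~~ heavy e (v 1).
Proof. by apply/negP => H1; apply: (no_heavy_consecutive vc H0 H1). Qed.

Lemma light_pred : ~~ heavy e (v n.-1).
Proof.
apply/negP => Hn; apply: (no_heavy_consecutive vc Hn).
by rewrite prednK; [rewrite (periodic_add vc 0 : v n = v 0) | idx].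
Qed.

Lemma succ_pred : ~~ E n.-1 1.
Proof.
have := no_heavy_bypass (v := v) (i := n.-1) vc; rewrite prednK; last by idx.
by rewrite (periodic_add vc 0 : v n = v 0) (periodic_add vc 1 : v n.+1 = v 1); apply.
Qed.

(* Pigeonhole over the pairs of neighbours of [v 0] at cyclic distance [k - 2] in
   [v 1, ..., v n.-1]: a pair whose arc does not wrap around closes a [k]-cycle
   through [v 0], and so does a wrapping one if an edge from [v 1] or [v n.-1]
   bridges the missing edge between these two vertices. *)
Lemma heavy_pairs : exists j j', [/\ 0 < j < j', j' + (n.+1 - k) < n,
  [/\ E 0 j, E 0 j', E 0 (j + (n.+1 - k)) & E 0 (j' + (n.+1 - k))],
  E 1 (j + (n.+1 - k)) = false /\ E 1 (j' + (n.+1 - k)) = false &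
  E j n.-1 = false /\ E j' n.-1 = false].
Proof.
have kn' : k < n := missing_lt vc.
have km : k - 2 <= n.-1 by idx.
have wrap j : 0 < j -> j + (n.+1 - k) < n -> E 0 j -> E 0 (j + (n.+1 - k)) ->
    E 1 (j + (n.+1 - k)) = false /\ E j n.-1 = false.
  move=> j0 jn e1 e2; split; apply/negP => e3.
    apply: (@missing_index_cycle 0 n.-1 (0 :: rev (up 1 j) ++ up (j + (n.+1 - k)) n.-1)).
    - apply: (chain_cons (b := j)) => //.
      apply: (chain_cat (chain_down j0) _ e3); apply: (periodic_chain vc); idx.
    - exact: edge_last.
    - by uniq_nat.
    - by mem_nat.
    by size_nat.
  apply: (@missing_index_cycle 0 1 (0 :: up (j + (n.+1 - k)) n.-1 ++ rev (up 1 j))).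
  - apply: (chain_cons (b := j + (n.+1 - k))) => //.
    apply: (chain_cat (b := n.-1) (c := j)); last by rewrite /= sym.
      by apply: (periodic_chain vc); idx.
    exact: chain_down.
  - exact: edge_back.
  - by uniq_nat.
  - by mem_nat.
  by size_nat.
have cnt : count (fun i => E 0 i) (iota 1 n.-1) = deg e (v 0).
  have n0 : 0 < n by idx.
  have iE : iota 0 n = 0 :: iota 1 n.-1 by case: (n) n0.
  by rewrite (deg_count _ vc) iE /= irr.
have : n.-1 + 2 <= count (fun i => E 0 i) (iota 1 n.-1) + count (fun i => E 0 i) (iota 1 n.-1).
  by rewrite cnt; move: H0; rewrite /heavy; idx.
move/(count_shift km).
have -> : count (fun i => E 0 i && E 0 (i + (k - 2))) (iota 1 (n.-1 - (k - 2))) = 0.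
  apply/eqP; rewrite eqn0Ngt -has_count; apply/hasPn => i; rewrite mem_iota => iR.
  by apply/negP => /andP[e1 e2]; apply: (no_fan _ _ e1 e2); idx.
rewrite add0n (_ : n.-1 - (k - 2) = n.+1 - k); last by idx.
case/count_gt1 => j [j' [jj' j1 jk /andP[e1 e2] /andP[e3 e4]]].
have [w1 w2] := wrap j j1 (ltac:(idx)) e2 e1.
have [w3 w4] := wrap j' (ltac:(idx)) (ltac:(idx)) e4 e3.
by exists j, j'; split=> //; idx.
Qed.

Lemma edge_first : E 0 1.
Proof. by have [] := vc. Qed.

Lemma edge_last' : E 0 n.-1.
Proof. by rewrite sym edge_last. Qed.

(** Claw at [v 0], whose leaves [v 1] and [v n.-1] are light and not adjacent. *)
Lemma adj_ends i : 1 < i < n.-1 -> E 0 i -> E 1 i || E n.-1 i.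
Proof.
move=> iR e0i; have nk := missing_lt vc; rewrite orbC.
apply: (clawH edge_last' edge_first e0i); rewrite ?light_pred ?light_succ ?succ_pred //;
  by apply: index_neq; idx.
Qed.

Section Sides.
Variable s : nat.
Hypotheses (sR : 1 < s < n.-1)
  (cut : forall i j, 0 < i < s -> s < j < n -> E i j = false).

Lemma adj_succ i : 1 < i < s -> E 0 i -> E 1 i.
Proof.
move=> iR /adj_ends; rewrite [E n.-1 i]sym (cut (i := i)); [|idx..].
by rewrite orbF; apply; idx.
Qed.

Lemma adj_pred i : s < i < n.-1 -> E 0 i -> E n.-1 i.
Proof. by move=> iR /adj_ends; rewrite cut; [|idx..]; apply; idx. Qed.

(** Triangle [v n.-1], [v q], [v 0] with tail [v u], [v w]: no edge crosses the cut, so [v w] can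
    only see [v 0]. Adjacency to [v 0] thus spreads from its light neighbours. *)
Lemma absorb_left q u w : s < q < n.-1 -> E 0 q -> 0 < u < s -> 0 < w < s ->
  ~~ heavy e (v u) -> E 0 u -> E u w -> E 0 w.
Proof.
move=> qR e0q uR wR uL e0u euw; have eq0 : E q 0 by rewrite sym.
have f1 : E n.-1 u = false by rewrite sym; apply: cut; idx.
have f2 : E q u = false by rewrite sym; apply: cut; idx.
have f3 : E n.-1 w = false by rewrite sym; apply: cut; idx.
have f4 : E q w = false by rewrite sym; apply: cut; idx.
have := z2H (adj_pred qR e0q) edge_last eq0 e0u euw (negbT f1) (negbT f2) uL.
by rewrite f3 f4 (negPf light_pred) => /(_ isT).
Qed.

Lemma absorb_right p u w : 1 < p < s -> E 0 p -> s < u < n -> s < w < n ->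
  ~~ heavy e (v u) -> E 0 u -> E u w -> E 0 w.
Proof.
move=> pR e0p uR wR uL e0u euw; have ep0 : E p 0 by rewrite sym.
have e10 : E 1 0 by apply: edge_back.
have f1 : E 1 u = false by apply: cut; idx.
have f2 : E p u = false by apply: cut; idx.
have f3 : E 1 w = false by apply: cut; idx.
have f4 : E p w = false by apply: cut; idx.
have := z2H (adj_succ pR e0p) e10 ep0 e0u euw (negbT f1) (negbT f2) uL.
by rewrite f3 f4 (negPf light_succ) => /(_ isT).
Qed.

(** * A heavy vertex with inner neighbours on both sides of the cut *)

Section TwoSided.
Variables p q : nat.
Hypotheses (pR : 1 < p < s) (e0p : E 0 p) (qR : s < q < n.-1) (e0q : E 0 q).
Hypothesis right_light : forall i, s < i < n -> ~~ heavy e (v i).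

Lemma right_full i : s < i < n -> E 0 i.
Proof.
move=> iR; have -> : i = n.-1 - (n.-1 - i) by idx.
have : n.-1 - i < n.-1 - s by idx.
elim: (n.-1 - i) => [|d IHd] dR; first by rewrite subn0 edge_last'.
apply: (absorb_right pR e0p (u := n.-1 - d)); [idx | idx | apply: right_light; idx | apply: IHd; idx |].
by rewrite (_ : n.-1 - d = (n.-1 - d.+1).+1) ?edge_back //; idx.
Qed.

(** The index [i] is that of the first heavy vertex on the left, or [s] if the left side is
    light. *)
Lemma first_heavy : exists i, [/\ 1 < i <= s, forall j, 0 < j < i -> ~~ heavy e (v j),
  forall j, 0 < j < s -> j <= i -> E 0 j & i < s -> heavy e (v i)].
Proof.
pose P i := (i == s) || (0 < i) && heavy e (v i).
have Ps : P s by rewrite /P eqxx.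
have [i Pi imin] := ex_minnP (ex_intro P s Ps).
have lt j : 0 < j < i -> ~~ heavy e (v j).
  by move=> jR; apply/negP => Hj; have := imin j; rewrite /P Hj andbT => /(_ _); lia.
exists i; split=> //.
- have := imin s Ps; case: i Pi {imin lt} => [|[|i]]; rewrite /P //.
  + by case/orP => [/eqP|//]; idx.
  by case/orP => [/eqP|]; [idx | rewrite (negPf light_succ)].
- elim=> // -[_|j IHj] jR ji; first exact: edge_first.
  apply: (absorb_left qR e0q (u := j.+1)); [idx | idx | apply: lt; idx | apply: IHj; idx |].
  by have [] := vc.
by move=> lis; case/orP: Pi => [/eqP|/andP[]//]; idx.
Qed.

Section FirstHeavy.
Variable i : nat.
Hypotheses (iR : 1 < i < s) (iL : forall j, 0 < j < i -> ~~ heavy e (v j))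
  (iF : forall j, 0 < j <= i -> E 0 j) (iH : heavy e (v i)).

(* The edge would give a Hamilton cycle on which [v 0] and [v l] are consecutive. *)
Lemma heavy_shift l : 1 < l < n.-1 -> E 0 l -> heavy e (v l) -> E 1 l.+1 = false.
Proof.
move=> lR e0l lH; apply/negP => e1l; have nk := missing_lt vc.
pose L := 0 :: rev (up 1 l) ++ up l.+1 n.-1.
have Lc : chain (relpre v e) 0 n.-1 L.
  apply: (chain_cons (b := l)) => //; apply: (chain_cat (b := 1) (c := l.+1)) => //.
    by apply: chain_down; idx.
  by apply: (periodic_chain vc); idx.
have uL : uniq L by rewrite /L; uniq_nat.
have Ln : {in L &, injective v} by apply: (periodic_inj vc); rewrite /L; mem_nat.
have [us cs] := @index_seq _ e v _ _ _ Lc edge_last uL Ln.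
have x0 : v 0 \in map v L by apply: map_f; rewrite mem_head.
apply: (no_heavy_cycle_edge us _ cs x0 H0); first by rewrite size_map /L; size_nat.
have [m lm] : exists m, l = m.+1 by exists l.-1; idx.
have -> : next (map v L) (v 0) = v l => //.
rewrite /L lm (_ : up 1 m.+1 = rcons (up 1 m) m.+1) ?rev_rcons /= ?eqxx //.
have -> : up 1 m.+1 = iota 1 (m + 1) by rewrite /up subn1 addn1.
by rewrite iotaD cats1 add1n /up subn1.
Qed.

(** Claw at [v l] with leaves [v l.-1], [v l.+1], [v 1]: the first two are light and not adjacent,
    and [heavy_shift] separates [v l.+1] from [v 1]. *)
Lemma heavy_prev l : 2 < l < s -> E 0 l -> heavy e (v l) -> E 1 l.-1.
Proof.
move=> lR e0l lH; have nk := missing_lt vc.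
have e1l : E 1 l by apply: adj_succ => //; idx.
have ell : E l l.-1 by rewrite -{1}[l]prednK ?edge_back //; idx.
have ell' : E l l.+1 by have [] := vc.
have el1 : E l 1 by rewrite sym.
have L1 : ~~ heavy e (v l.-1).
  apply/negP => h1; apply: (no_heavy_consecutive vc h1); rewrite prednK //; idx.
have L2 : ~~ heavy e (v l.+1) by apply/negP => h2; apply: (no_heavy_consecutive vc lH h2).
have nb : ~~ E l.-1 l.+1.
  have := no_heavy_bypass (v := v) (i := l.-1) vc; rewrite prednK; last by idx.
  by apply.
have := clawH ell ell' el1 _ _ _ L1 L2 nb.
rewrite [E l.+1 1]sym (heavy_shift _ e0l lH) ?orbF; last by idx.
by rewrite [E 1 _]sym; apply; apply: index_neq; idx.
Qed.

(** The first neighbour [v l] of [v 0] beyond [v i] would make [v l.-1] a neighbour too: by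
    absorption from [v l] if it is light, from [v 1] if it is heavy. The case [l = i.+1] contradicts
    [heavy_shift] at [i], or makes two consecutive vertices heavy. *)
Lemma left_neighbours l : i < l < s -> E 0 l = false.
Proof.
have [m lm] := ubnP l; elim: m l lm => // m IHm l lm lR; apply/negP => e0l.
have nk := missing_lt vc.
have f3 : E 1 i.+1 = false by apply: heavy_shift => //; [idx | apply: iF; idx].
have [le|li] := eqVneq l i.+1.
  have [lH|lL] := boolP (heavy e (v l)).
    by apply: (no_heavy_consecutive vc iH); rewrite -le.
  by have := adj_succ (i := l) _ e0l; rewrite le f3 => /(_ _); idx.
have f : E 0 l.-1 = false by apply: IHm; idx.
have [lH|lL] := boolP (heavy e (v l)).
  have e1 : E 1 l.-1 by apply: heavy_prev => //; idx.
  have := absorb_left qR e0q (u := 1) (w := l.-1) _ _ light_succ edge_first e1.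
  by rewrite f => /(_ _ _); idx.
have ell : E l l.-1 by rewrite -{1}[l]prednK ?edge_back //; idx.
have := absorb_left qR e0q (u := l) (w := l.-1) _ _ lL e0l ell.
by rewrite f => /(_ _ _); idx.
Qed.

(** A heavy [v l] could share only [v i] and [v s] with [v 0], because a light common neighbour
    before [v i] would make it adjacent to [v 0]. *)
Lemma left_light l : i < l < s -> ~~ heavy e (v l).
Proof.
move=> lR; apply/negP => lH; have nk := missing_lt vc.
have e0l := left_neighbours lR.
have I : [set t | e (v 0) t] :&: [set t | e (v l) t] \subset [set v i; v s].
  apply/subsetP => t; have [j jn <-] := periodic_surj t vc.
  rewrite !inE => /andP[e0j elj].
  have [->|ji] := eqVneq j i; first by rewrite eqxx.
  have [->|js] := eqVneq j s; first by rewrite eqxx orbT.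
  have [j0|j0] := posnP j; first by rewrite j0 irr in e0j.
  have [/andP[ij jl]|] := boolP (i < j < s).
    by rewrite (left_neighbours (l := j)) ?ij in e0j.
  move=> nij; have [js'|js'] := ltnP j s; last first.
    by have : E l j = false; [apply: cut; idx | rewrite elj].
  have jR : 0 < j < i by move: nij; idx.
  have := absorb_left qR e0q (u := j) (w := l) _ _ (iL jR) e0j.
  by rewrite e0l sym elj => /(_ _ _ isT); idx.
by apply: (heavy_common_neighbours H0 lH _ _ I); [apply: index_neq; idx | rewrite e0l].
Qed.

(** Triangle [v 1], [v 0], [v i] with tail [v u], [v u.+1] carries adjacency to [v i] one step
    further. *)
Lemma heavy_full u : i < u < s -> E i u.
Proof.
elim: u => // u IHu uR; have [->|ui] := eqVneq u i; first by have [] := vc.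
have uR' : i < u < s by idx.
have f1 w : i < w < s -> E 1 w = false.
  move=> wR; apply/negP => e1w.
  have := absorb_left qR e0q (u := 1) (w := w) _ _ light_succ edge_first e1w.
  by rewrite left_neighbours // => /(_ _ _); idx.
have e10 : E 1 0 by apply: edge_back.
have e1i : E 1 i by apply: adj_succ; [idx | apply: iF; idx].
have e0i : E 0 i by apply: iF; idx.
have := z2H e10 e1i e0i (IHu uR') (vc.1 u).
rewrite !f1 // !left_neighbours // (negPf light_succ) => /(_ isT isT _ isT).
by apply; apply: left_light.
Qed.

Lemma last_attached : [|| E i s, E 0 s | E 1 s].
Proof.
have [si|si] := eqVneq s i.+1; first by rewrite si; have [->] := vc.
have uR : i < s.-1 < s by idx.
have f1 : E 1 s.-1 = false.
  apply/negP => e1w.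
  have := absorb_left qR e0q (u := 1) (w := s.-1) _ _ light_succ edge_first e1w.
  by rewrite left_neighbours // => /(_ _ _); idx.
have e10 : E 1 0 by apply: edge_back.
have e1i : E 1 i by apply: adj_succ; [idx | apply: iF; idx].
have e0i : E 0 i by apply: iF; idx.
have es : E s.-1 s by have := vc.1 s.-1; rewrite prednK //; idx.
have := z2H e10 e1i e0i (heavy_full uR) es.
rewrite f1 left_neighbours // (negPf light_succ) (left_light uR) => /(_ isT isT isT isT).
by case/or3P => ->; rewrite ?orbT.
Qed.

(** Lengths from [s + 3 - i] on come from fans at [v 0] reaching across the gap between [i] and [s],
    lengths up to [s - i] from fans at [v i]; the two lengths in between use [last_attached]. *)
Lemma first_heavy_absurd : False.
Proof.
have nk := missing_lt vc; have last := last_attached; have hf := heavy_full.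
have rf j : s < j < n -> E 0 j by apply: right_full.
have edge j : E j j.+1 by have [] := vc.
have up_chain a b : a <= b -> chain (relpre v e) a b (up a b) by apply: (periodic_chain vc).
have [k3|k3] := leqP k 3.
  by apply: (no_fan (j := 1)); [idx | idx | apply: iF; idx | apply: iF; idx].
have [kl|kl] := leqP (s + 3) (i + k).
  have [ks|ks] := leqP s (k - 2).
    by apply: (no_fan (j := 1)); [idx | idx | apply: iF; idx | apply: rf; idx].
  by apply: (no_fan (j := s + 3 - k)); [idx | idx | apply: iF; idx | apply: rf; idx].
have eih j : i.+1 < j < s -> E i j by move=> jR; apply: hf; idx.
have [ks|ks] := leqP (i + k) s.
  apply: (@missing_index_cycle i (i + k.-1) (i :: up i.+1 (i + k.-1))).
  - by apply: (chain_cons (b := i.+1)); [apply: up_chain; idx | exact: edge].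
  - by rewrite sym; apply: eih; idx.
  - by uniq_nat.
  - by mem_nat.
  by size_nat.
have kE : i + k = s.+1 \/ i + k = s.+2 by idx.
have e0i : E 0 i by apply: iF; idx.
have e1i : E 1 i by apply: adj_succ; [idx | exact: e0i].
have [eis|neis] := boolP (E i s).
  case: kE => kE.
    apply: (@missing_index_cycle i s (i :: up i.+1 s)).
    - by apply: (chain_cons (b := i.+1)); [apply: up_chain; idx | exact: edge].
    - by rewrite sym.
    - by uniq_nat.
    - by mem_nat.
    by size_nat.
  apply: (@missing_index_cycle 0 s.+1 (0 :: i :: up i.+2 s.+1)).
  - apply: (chain_cons (b := i)) => //; apply: (chain_cons (b := i.+2)).
      by apply: up_chain; idx.
    have [<-//|ne] := eqVneq s i.+2.
    by apply: eih; idx.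
  - by rewrite sym; apply: rf; idx.
  - by uniq_nat.
  - by mem_nat.
  by size_nat.
have ei2 : i.+3 <= s -> E i i.+2 by move=> ?; apply: eih; idx.
have [e0s|ne0s] := boolP (E 0 s).
  case: kE => kE.
    have is3 : i.+3 <= s by idx.
    apply: (@missing_index_cycle 0 s (0 :: i :: up i.+2 s)).
    - apply: (chain_cons (b := i)) => //; apply: (chain_cons (b := i.+2)); last exact: ei2.
      by apply: up_chain; idx.
    - by rewrite sym.
    - by uniq_nat.
    - by mem_nat.
    by size_nat.
  have iE : i + (k - 2) = s by idx.
  by apply: (no_fan (j := i)) e0i _; rewrite ?iE //; idx.
have e1s : E 1 s by move: last; rewrite (negPf neis) (negPf ne0s).
case: kE => kE.
  have is3 : i.+3 <= s by idx.
  apply: (@missing_index_cycle 1 s (1 :: i :: up i.+2 s)).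
  - apply: (chain_cons (b := i)) => //; apply: (chain_cons (b := i.+2)); last exact: ei2.
    by apply: up_chain; idx.
  - by rewrite sym.
  - by uniq_nat.
  - by mem_nat.
  by size_nat.
apply: (@missing_index_cycle 1 s (1 :: i :: up i.+1 s)).
- apply: (chain_cons (b := i)) => //; apply: (chain_cons (b := i.+1)); last exact: edge.
  by apply: up_chain; idx.
- by rewrite sym.
- by uniq_nat.
- by mem_nat.
by size_nat.
Qed.

End FirstHeavy.

Lemma right_light_absurd : False.
Proof.
have [i [iR iL iF iH]] := first_heavy; have nk := missing_lt vc.
have [lis|sli] := ltnP i s.
  apply: (@first_heavy_absurd i) => //; [idx | | exact: iH].
  by move=> j jR; apply: iF; idx.
have full j : 0 < j < n -> j != s -> E 0 j.
  move=> jR js; have [lt|gt] := ltnP j s; first by apply: iF; idx.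
  by apply: right_full; idx.
(* Here [v 0] sees every vertex except possibly [v s], so a fan that would end in [v s] is moved by
   one. *)
have [ks|ks] := eqVneq (1 + (k - 2)) s.
  by apply: (no_fan (j := 2)); [idx | idx | apply: full; idx | apply: full; idx].
by apply: (no_fan (j := 1)); [idx | idx | apply: full; idx | apply: full; idx].
Qed.

End TwoSided.
End Sides.

End Cut.

(** * Reflection, and the remaining positions of the neighbours *)

Lemma periodic_reflect v : periodic_cycle e v n -> periodic_cycle e (fun i => v (n - i %% n)) n.
Proof.
move=> vc; have [ve vk] := vc; have n0 : 0 < n by idx.
split=> [i|i j].
  have := ltn_pmod i n0; rewrite -(addn1 i) -(modnDml i 1); move: (i %% n) => r rn.
  have [rE|ne] := eqVneq r n.-1.
    have -> : r + 1 = n by idx.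
    have -> : n - r = 1 by idx.
    by rewrite modnn subn0 (periodic_add vc 0 : v n = v 0) sym.
  rewrite modn_small; last by idx.
  have -> : n - r = (n - (r + 1)).+1 by idx.
  by rewrite sym.
have := ltn_pmod i n0; have := ltn_pmod j n0; rewrite vk.
move: (i %% n) (j %% n) => a b bn an; have [->|ab] := eqVneq a b; first by rewrite !eqxx.
have [a0|a0] := posnP a; have [b0|b0] := posnP b.
- by rewrite a0 b0 eqxx in ab.
- by rewrite a0 subn0 modnn modn_small; [apply/eqP; idx | idx].
- by rewrite b0 subn0 modnn modn_small; [apply/eqP; idx | idx].
by rewrite !modn_small; [apply/eqP; idx | idx | idx].
Qed.

(** Heavy vertices on opposite sides could share only [v 0] and [v s], so one side is light; a
    reflection makes it the right one. *)
Lemma two_sided v s p q : periodic_cycle e v n -> heavy e (v 0) -> 1 < s < n.-1 ->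
  (forall i j, 0 < i < s -> s < j < n -> e (v i) (v j) = false) ->
  1 < p < s -> e (v 0) (v p) -> s < q < n.-1 -> e (v 0) (v q) -> False.
Proof.
move=> vc H0 sR cut pR e0p qR e0q.
have [right_light|] := boolP (all (fun i => ~~ heavy e (v i)) (up s.+1 n.-1)).
  apply: (right_light_absurd vc H0 sR cut pR e0p qR e0q) => i iR.
  by move/allP: right_light; apply; rewrite mem_up; idx.
case/allPn => w; rewrite mem_up negbK => wR wH.
have left_light i : 0 < i < s -> ~~ heavy e (v i).
  move=> iR; apply/negP => iH.
  apply: (heavy_common_neighbours (a := v 0) (b := v s) iH wH).
  - by apply: (index_neq vc); idx.
  - by rewrite cut //; idx.
  apply/subsetP => t; have [j jn <-] := periodic_surj t vc.
  rewrite !inE => /andP[eij ewj].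
  have [->|j0] := eqVneq j 0; first by rewrite eqxx.
  have [->|js] := eqVneq j s; first by rewrite eqxx orbT.
  have [lt|gt] : j < s \/ s < j by idx.
    by rewrite sym cut // in ewj; idx.
  by rewrite cut // in eij; idx.
have nk := missing_lt vc; have r j : 0 < j < n -> v (n - j %% n) = v (n - j).
  by move=> jR; rewrite modn_small //; idx.
have rE j : 0 < j < n -> n - (n - j) = j by idx.
have r0 : v (n - 0 %% n) = v 0 by rewrite mod0n subn0 (periodic_add vc 0 : v n = v 0).
apply: (@right_light_absurd _ (periodic_reflect vc) _ (n - s) _ _ (n - q) (n - p)); rewrite ?r0 //.
- by idx.
- move=> i j iR jR; rewrite !r; [|idx..].
  by rewrite sym cut //; idx.
- by idx.
- by rewrite r ?rE //; idx.
- by idx.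
- by rewrite r ?rE //; idx.
by move=> i iR; rewrite r; [apply: left_light; idx | idx].
Qed.

(* Here [v 1] has degree two; a cycle through all vertices but [v 0] and [v 1]
   contains so many neighbours of [v 0] that cycles of all lengths below [n] arise. *)
Lemma degree_two_succ v : periodic_cycle e v n -> heavy e (v 0) -> 4 < n ->
  (forall j, 2 < j < n -> e (v 1) (v j) = false) -> e (v 0) (v 2) ->
  two_connected_on e [set t in map v (up 2 n.-1)] -> False.
Proof.
move=> vc H0 n4 cut e02; set U := [set t in _] => tc.
have nk := missing_lt vc; have ab : 4 <= n.-1 by idx.
have ban : n.-1 < 2 + n by idx.
have UE i : i < n -> (v i \in U) = (1 < i).
  move=> ik; have [i1|i1] := leqP i 1; last by apply: interval_mem; idx.
  rewrite inE; apply/mapP => -[j]; rewrite mem_up => jR /eqP; apply/negP.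
  by apply: (index_neq vc); idx.
have cU : #|U| = n - 2 by rewrite (card_interval vc) //; idx.
have out u : u \in U -> #|[set t | e u t] :\: U| <= 1 + (u == v 2).
  move=> uU; have [m mn um] := periodic_surj u vc; subst u.
  rewrite UE // in uU.
  have sub : [set t | e (v m) t] :\: U \subset v 0 |: (if v m == v 2 then [set v 1] else set0).
    apply/subsetP => t; have [j jn <-] := periodic_surj t vc.
    rewrite in_setD UE // -leqNgt => /andP[j1]; rewrite inE => emj.
    have [->|j0] := eqVneq j 0; first by rewrite setU11.
    have j1' : j = 1 by idx.
    subst j; case: eqP => [_|ne]; first by rewrite !inE eqxx orbT.
    have m2 : m != 2 by apply: contra_notN ne => /eqP->.
    by rewrite sym cut // in emj; idx.
  apply: leq_trans (subset_leq_card sub) _.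
  by apply: leq_trans (leq_card_setU _ _) _; rewrite cards1; case: ifP; rewrite ?cards1 ?cards0.
have [|C [uO CU cO]] := hamiltonian_on sym irr clawH z2H tc.
  move=> u w uU wU Hu Hw uw; rewrite cU.
  have := degree_interval v 2 n.-1 u; have := degree_interval v 2 n.-1 w; rewrite -/U.
  have := out u uU; have := out w wU; move: Hu Hw; rewrite /heavy.
  have : (u == v 2) + (w == v 2) <= 1.
    case: (eqVneq u (v 2)) => [uE|_]; case: (eqVneq w (v 2)) => [wE|_] //.
    by move: uw; rewrite uE wE eqxx.
  by clear; lia.
have x0 : v 0 \notin C by rewrite CU UE //; idx.
have x1 : v 1 \notin C by rewrite CU UE //; idx.
have sO : size C = n - 2 by rewrite -cU -(card_uniqP uO); apply: eq_card.
have uC1 : uniq (v 1 :: C) by rewrite /= x1.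
have x01 : v 0 \notin v 1 :: C by rewrite inE negb_or x0 (index_neq vc) //; idx.
have sO1 : size (v 1 :: C) = n.-1.
  by rewrite /= sO; move: n4; move: #|T|; clear => m; lia.
have cntE : (count (e (v 0)) C).+1 = deg e (v 0).
  rewrite -(count_deg uC1); last by move=> y; apply: (dominated uC1 x01 sO1).
  by rewrite /= (edge_first vc).
have := no_dominating_cycle uO cO x0; rewrite sO.
by move: H0 nk kn; rewrite /heavy -cntE; clear; case: (count _ _) => [|c]; lia.
Qed.

(** The case in which fans at [v 0] do not produce the length 4. The absence of 4-cycles makes [v 2]
    light, and the triangle [v 6], [v 5], [v 0] with tail [v 2], [v 3] violates the Z_2
    condition. *)
Lemma seven_vertices v : periodic_cycle e v n -> heavy e (v 0) -> n = 7 -> k = 4 ->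
  e (v 0) (v 2) -> e (v 0) (v 3) = false -> e (v 0) (v 5) -> e (v 2) (v 6) = false ->
  e (v 3) (v 6) = false -> False.
Proof.
move=> vc H0 n7 k4 e02 e03 e05 e26 e36; have [ve _] := vc.
have e60 : e (v 6) (v 0) by have := edge_last vc; rewrite n7.
have cyc a b L : chain (relpre v e) a b L -> e (v b) (v a) -> uniq L ->
  all (fun i => i < 7) L -> size L = 4 -> False.
  by move=> Lc ba uL Ln sL; apply: (missing_index_cycle vc Lc ba uL); rewrite ?n7 ?k4.
have e25 : e (v 2) (v 5) = false.
  apply/negP => e25; apply: (cyc 0 5 [:: 0; 1; 2; 5]) => //; last by rewrite sym.
  by rewrite /= eqxx !ve e25.
have e24 : e (v 2) (v 4) = false.
  apply/negP => e24; apply: (cyc 0 5 [:: 0; 2; 4; 5]) => //; last by rewrite sym.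
  by rewrite /= eqxx !ve e02 e24.
have e35 : e (v 3) (v 5) = false.
  apply/negP => e35; apply: (cyc 0 5 [:: 0; 2; 3; 5]) => //; last by rewrite sym.
  by rewrite /= eqxx !ve e02 e35.
have L2 : ~~ heavy e (v 2).
  rewrite /heavy n7 (deg_count _ vc) n7 /= e24 e25 e26 irr.
  by case: (e _ _); case: (e _ _); case: (e _ _).
have L6 : ~~ heavy e (v 6) by have := light_pred vc H0; rewrite n7.
have e65 : e (v 6) (v 5) by rewrite sym.
have e50 : e (v 5) (v 0) by rewrite sym.
have n62 : ~~ e (v 6) (v 2) by rewrite sym e26.
have n52 : ~~ e (v 5) (v 2) by rewrite sym e25.
have := z2H e65 e60 e50 e02 (ve 2) n62 n52 L2.
by rewrite (negPf L6) e03 [e _ (v 3)]sym e36 [e _ (v 3)]sym e35 => /(_ isT).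
Qed.

(** If [v 0] has no inner neighbour on the right either, the pairs of [heavy_pairs] meet in [v s],
    against [adj_ends]. Otherwise [s = 2], and deleting [v 1] as well leads to [degree_two_succ] or
    to a second cut [s'], with [v 2] as an inner left neighbour. *)
Lemma one_sided v s : periodic_cycle e v n -> heavy e (v 0) -> 1 < s < n.-1 ->
  (forall i j, 0 < i < s -> s < j < n -> e (v i) (v j) = false) ->
  (forall i, 1 < i < s -> e (v 0) (v i) = false) -> False.
Proof.
move=> vc H0 sR cut none; have nk := missing_lt vc.
have [j [j' [jR jn [e1 e2 e3 e4] [n1 n2] [n3 n4]]]] := heavy_pairs vc H0.
set d := n.+1 - k in jn e3 e4 n1 n2.
have dR : 2 <= d by rewrite /d; idx.
have [hq|/hasPn nq] := boolP (has (fun q => e (v 0) (v q)) (up s.+1 n.-2)); last first.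
  have only i : 1 < i < n.-1 -> e (v 0) (v i) -> i = s.
    move=> iR e0i; apply/eqP; case: ltngtP => // is'.
      by have : e (v 0) (v i) = false; [apply: none; idx | rewrite e0i].
    by have /negP := nq i (ltac:(rewrite mem_up; idx)).
  have j's : j' = s by apply: only => //; idx.
  have jds : j + d = s by apply: only => //; idx.
  have := adj_ends vc H0 sR; rewrite -{1}j's e2 -{1}jds n1 -j's sym n4.
  by move=> /(_ isT).
case/hasP: hq => q; rewrite mem_up => qR' e0q; have qR : s < q < n.-1 by idx.
have s2 : s = 2.
  apply/eqP; case: ltngtP => // s2; first by idx.
  have := absorb_left vc H0 sR cut qR e0q (u := 1) (w := 2) _ _ (light_succ vc H0) (edge_first vc) (vc.1 1).
  by rewrite none; [move=> /(_ _ _); idx | idx].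
have j'2 : j' = 2.
  apply/eqP; case: ltngtP => // j'2; first by idx.
  have := adj_pred vc H0 sR cut (i := j') _ e2; rewrite sym n4 => /(_ _); idx.
have j1 : j = 1 by idx.
subst s j' j.
have ab : 4 <= n.-1 by idx.
have ban : n.-1 < 2 + n by idx.
have [[s' sR' cut']|] := cut_or_two_connected vc ab ban; last first.
  by apply: degree_two_succ => // [|i iR]; [idx | apply: cut; idx].
have cut1 i l : 0 < i < s' -> s' < l < n -> e (v i) (v l) = false.
  move=> iR lR; have [->|i1] := eqVneq i 1; first by apply: cut; idx.
  by apply: cut'; idx.
have sR1 : 1 < s' < n.-1 by idx.
have p2 : 1 < 2 < s' by idx.
have [/hasP[q']|/hasPn nq'] := boolP (has (fun q => e (v 0) (v q)) (up s'.+1 n.-2)).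
  rewrite mem_up => q'R e0q'.
  by apply: (two_sided vc H0 sR1 cut1 p2 e2 _ e0q'); idx.
(* Otherwise absorption from [v n.-1] makes [v (n - 2)] an inner right neighbour of [v 0]. *)
have s'E : s' = n - 2.
  apply/eqP; case: ltngtP => // s'2; last by idx.
  have ek : e (v n.-1) (v (n - 2)).
    by rewrite (_ : n.-1 = (n - 2).+1) ?(edge_back vc) //; idx.
  have := absorb_right vc H0 sR1 cut1 p2 e2 (u := n.-1) (w := n - 2) _ _
    (light_pred vc H0) (edge_last' vc) ek.
  have /negPf-> := nq' (n - 2) (ltac:(rewrite mem_up; idx)).
  by move=> /(_ _ _); idx.
(* The first cut would force an edge to [v n.-1], which the second cut forbids. *)
have mid u : 2 < u < n - 2 -> e (v 0) (v u) = false.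
  move=> uR; apply/negP => e0u.
  have := adj_pred vc H0 sR cut (i := u) _ e0u; rewrite sym cut1; [|idx..].
  by move=> /(_ _); idx.
have dE : d = n - 3.
  apply/eqP; case: ltngtP => // d3; last by idx.
  by have : e (v 0) (v (1 + d)) = false; [apply: mid; idx | rewrite e3].
have k4 : k = 4 by rewrite /d in dE; idx.
have e0n2 : e (v 0) (v (n - 2)) by rewrite (_ : n - 2 = 1 + d) //; idx.
(* A heavy vertex with at most four neighbours; [n = 5] and [n = 6] are settled by fans of length
   4. *)
have n8 : n < 8.
  apply: leq_trans H0 _; rewrite -[8]/(4.*2) leq_double.
  apply: leq_trans (card_size [:: v 1; v 2; v (n - 2); v n.-1]).
  apply: subset_leq_card; apply/subsetP => t; have [i ik <-] := periodic_surj t vc.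
  rewrite !inE => e0i; have [i0|i0] := posnP i; first by rewrite i0 irr in e0i.
  have [->|i1] := eqVneq i 1; first by rewrite eqxx.
  have [->|i2] := eqVneq i 2; first by rewrite eqxx orbT.
  have [->|i3] := eqVneq i (n - 2); first by rewrite eqxx !orbT.
  have [->|i4] := eqVneq i n.-1; first by rewrite eqxx !orbT.
  by have : e (v 0) (v i) = false; [apply: mid; idx | rewrite e0i].
have [n7|n7] := eqVneq n 7.
  apply: (seven_vertices vc H0 n7 k4 e2).
  - by apply: mid; idx.
  - by move: e0n2; rewrite n7.
  - by apply: cut1; idx.
  by apply: cut1; idx.
have [n6|n6] := eqVneq n 6.
  have fE : 2 + (k - 2) = n - 2 by idx.
  by apply: (no_fan vc (j := 2)) => //; rewrite fE //; idx.
have fE : 1 + (k - 2) = n - 2 by idx.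
by apply: (no_fan vc (j := 1)) => //; rewrite fE //; idx.
Qed.

Lemma heavy_absurd v : periodic_cycle e v n -> heavy e (v 0) -> False.
Proof.
move=> vc H0; have [s sR cut] := cut_exists vc H0; have nk := missing_lt vc.
have [/hasP[p]|/hasPn np] := boolP (has (fun i => e (v 0) (v i)) (up 2 s.-1)); last first.
  by apply: (one_sided vc H0 sR cut) => i iR; apply/negbTE/np; rewrite mem_up; idx.
have [/hasP[q]|/hasPn nq _ _] := boolP (has (fun i => e (v 0) (v i)) (up s.+1 n.-2)).
  rewrite !mem_up => qR e0q pR e0p.
  by apply: (two_sided vc H0 sR cut _ e0p _ e0q); idx.
have r j : 0 < j < n -> v (n - j %% n) = v (n - j).
  by move=> jR; rewrite modn_small //; idx.
have r0 : v (n - 0 %% n) = v 0 by rewrite mod0n subn0 (periodic_add vc 0 : v n = v 0).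
apply: (one_sided (periodic_reflect vc) (s := n - s)); rewrite ?r0 //.
- by idx.
- move=> i j iR jR; rewrite !r; [|idx..].
  by rewrite sym cut //; idx.
move=> i iR; rewrite r; last by idx.
by apply/negbTE/nq; rewrite mem_up; idx.
Qed.

End Missing.
End HeavyFan.

(** * Induced patterns *)

Section Patterns.
Variables (T : finType) (e : rel T).
Hypotheses (sym : symmetric e) (irr : irreflexive e).

Lemma f1_heavy_pair (A : {set T}) u w v : f1_heavy_set e A -> u \in A -> w \in A -> v \in A ->
  e u w -> e w v -> u != v -> ~~ e u v -> heavy e u || heavy e v.
Proof.
move=> AH uA wA vA uw wv uv nuv.
have : dist_in e A u v 2.
  split; first by exists [:: w; v]; split; rewrite //= ?uw ?wv ?wA ?vA.
  case=> [|[|//]] _ [p [_ sp pp _ lp]].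
    by case: p sp pp lp => //= _ _ /eqP; rewrite (negPf uv).
  case: p sp pp lp => [|a [|]] //= _; rewrite andbT => ua av.
  by rewrite -av ua in nuv.
by move/(AH _ _ uA vA); rewrite /heavy; lia.
Qed.

(** Adjacent vertices have distinct images by irreflexivity, so distinctness is asked for
    non-adjacent pairs only. *)
Lemma pattern_heavy_pair (VR : finType) (r : rel VR) (f : VR -> T) (i j l : VR) :
  R_f1_heavy e r -> (forall x y, x != y -> ~~ r x y -> f x != f y) ->
  (forall x y, e (f x) (f y) = r x y) -> r i l -> r l j -> i != j -> ~~ r i j ->
  heavy e (f i) || heavy e (f j).
Proof.
move=> RH fne fr il lj ij nij.
have finj : injective f.
  move=> x y fxy; apply/eqP; apply: contraT => xy.
  have [rxy|nxy] := boolP (r x y); last by have := fne x y xy nxy; rewrite fxy eqxx.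
  by rewrite -fr fxy irr in rxy.
apply: (f1_heavy_pair (w := f l) (RH f finj fr)); rewrite ?imset_f ?inE ?fr //.
by rewrite (inj_eq finj).
Qed.

Lemma claw_heavyP : R_f1_heavy e claw_rel -> claw_heavy e (heavy e).
Proof.
move=> RH c a b d ca cb cd ab da db aL bL nab; apply: contraT; rewrite negb_or => /andP[nad nbd].
have [ac bc dc] : [/\ e a c, e b c & e d c] by rewrite ![e _ c]sym.
have [nba nda ndb] : [/\ ~~ e b a, ~~ e d a & ~~ e d b] by rewrite ![e b _]sym ![e d _]sym.
pose f (i : 'I_4) := nth c [:: c; a; b; d] i.
have fne x y : x != y -> ~~ claw_rel x y -> f x != f y.
  move: x y => [[|[|[|[|//]]]] ?] [[|[|[|[|//]]]] ?] //= _ _; rewrite /f //= 1?eq_sym //.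
have fr x y : e (f x) (f y) = claw_rel x y.
  move: x y => [[|[|[|[|//]]]] ?] [[|[|[|[|//]]]] ?]; rewrite /f /claw_rel /=;
  by rewrite ?irr ?ca ?cb ?cd ?ac ?bc ?dc ?(negPf nab) ?(negPf nad) ?(negPf nbd) ?(negPf nba) ?(negPf nda) ?(negPf ndb).
have := pattern_heavy_pair (i := Ordinal (isT : 1 < 4)) (j := Ordinal (isT : 2 < 4))
  (l := Ordinal (isT : 0 < 4)) RH fne fr isT isT isT isT.
by rewrite /f /= (negPf aL) (negPf bL).
Qed.

(** If [a5] sees no triangle vertex, then [a1, a4] and [a2, a4] are pairs at distance two in induced
    paths ending in [a3, a4, a5], in the Z_1 on [a1, ..., a4] and in the Z_2 on all five. As [a4] is
    light, [a1] and [a2] are heavy. *)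
Lemma z2_heavyP : R_f1_heavy e (P_rel 4) \/ R_f1_heavy e (Z_rel 1) \/ R_f1_heavy e (Z_rel 2) ->
  z2_heavy e (heavy e).
Proof.
move=> RH a1 a2 a3 a4 a5 e12 e13 e23 e34 e45 n14 n24 L4 L12; apply: contraT.
rewrite !negb_or => /and3P[n15 n25 n35]; case/negP: L12.
have [e21 e31 e32] : [/\ e a2 a1, e a3 a1 & e a3 a2] by split; rewrite sym.
have [e43 e54] : e a4 a3 /\ e a5 a4 by split; rewrite sym.
have [n41 n42] : ~~ e a4 a1 /\ ~~ e a4 a2 by split; rewrite sym.
have [n51 n52 n53] : [/\ ~~ e a5 a1, ~~ e a5 a2 & ~~ e a5 a3] by split; rewrite sym.
have d14 : a1 != a4 by apply: contraNneq n24 => <-.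
have d24 : a2 != a4 by apply: contraNneq n14 => <-.
have d15 : a1 != a5 by apply: contraNneq n14 => ->.
have d25 : a2 != a5 by apply: contraNneq n24 => ->.
have d35 : a3 != a5 by apply: contraNneq n15 => <-.
have P4 b : R_f1_heavy e (P_rel 4) -> e b a3 -> ~~ e b a4 -> ~~ e b a5 -> b != a4 -> b != a5 -> heavy e b.
  move=> PH b3 nb4 nb5 db4 db5; have b3' : e a3 b by rewrite sym.
  have [nb4' nb5'] : ~~ e a4 b /\ ~~ e a5 b by split; rewrite sym.
  pose f (i : 'I_4) := nth b [:: b; a3; a4; a5] i.
  have fne x y : x != y -> ~~ P_rel 4 x y -> f x != f y.
    by move: x y => [[|[|[|[|//]]]] ?] [[|[|[|[|//]]]] ?] //= _ _; rewrite /f //= 1?eq_sym.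
  have fr x y : e (f x) (f y) = P_rel 4 x y.
    move: x y => [[|[|[|[|//]]]] ?] [[|[|[|[|//]]]] ?]; rewrite /f /P_rel /=;
    by rewrite ?irr ?b3 ?b3' ?e34 ?e43 ?e45 ?e54 ?(negPf nb4) ?(negPf nb4') ?(negPf nb5) ?(negPf nb5') ?(negPf n35) ?(negPf n53).
  have := pattern_heavy_pair (i := Ordinal (isT : 0 < 4)) (j := Ordinal (isT : 2 < 4))
    (l := Ordinal (isT : 1 < 4)) PH fne fr isT isT isT isT.
  by rewrite /f /= (negPf L4) orbF.
case: RH => [PH|[ZH|ZH]]; first by rewrite !(P4 _ PH).
  pose f (i : 'I_(1 + 3)) := nth a1 [:: a1; a2; a3; a4] i.
  have fne x y : x != y -> ~~ Z_rel 1 x y -> f x != f y.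
    by move: x y => [[|[|[|[|//]]]] ?] [[|[|[|[|//]]]] ?] //= _ _; rewrite /f //= 1?eq_sym.
  have fr x y : e (f x) (f y) = Z_rel 1 x y.
    move: x y => [[|[|[|[|//]]]] ?] [[|[|[|[|//]]]] ?]; rewrite /f /Z_rel /=;
    by rewrite ?irr ?e12 ?e13 ?e23 ?e34 ?e21 ?e31 ?e32 ?e43 ?(negPf n14) ?(negPf n24) ?(negPf n41) ?(negPf n42).
  have := pattern_heavy_pair (i := Ordinal (isT : 0 < 1 + 3)) (j := Ordinal (isT : 3 < 1 + 3))
    (l := Ordinal (isT : 2 < 1 + 3)) ZH fne fr isT isT isT isT.
  have := pattern_heavy_pair (i := Ordinal (isT : 1 < 1 + 3)) (j := Ordinal (isT : 3 < 1 + 3))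
    (l := Ordinal (isT : 2 < 1 + 3)) ZH fne fr isT isT isT isT.
  by rewrite /f /= (negPf L4) !orbF => -> ->.
pose f (i : 'I_(2 + 3)) := nth a1 [:: a1; a2; a3; a4; a5] i.
have fne x y : x != y -> ~~ Z_rel 2 x y -> f x != f y.
  by move: x y => [[|[|[|[|[|//]]]]] ?] [[|[|[|[|[|//]]]]] ?] //= _ _; rewrite /f //= 1?eq_sym.
have fr x y : e (f x) (f y) = Z_rel 2 x y.
  move: x y => [[|[|[|[|[|//]]]]] ?] [[|[|[|[|[|//]]]]] ?]; rewrite /f /Z_rel /=;
  by rewrite ?irr ?e12 ?e13 ?e23 ?e34 ?e45 ?e21 ?e31 ?e32 ?e43 ?e54
    ?(negPf n14) ?(negPf n24) ?(negPf n41) ?(negPf n42) ?(negPf n15) ?(negPf n25) ?(negPf n35)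
    ?(negPf n51) ?(negPf n52) ?(negPf n53).
have := pattern_heavy_pair (i := Ordinal (isT : 0 < 2 + 3)) (j := Ordinal (isT : 3 < 2 + 3))
  (l := Ordinal (isT : 2 < 2 + 3)) ZH fne fr isT isT isT isT.
have := pattern_heavy_pair (i := Ordinal (isT : 1 < 2 + 3)) (j := Ordinal (isT : 3 < 2 + 3))
  (l := Ordinal (isT : 2 < 2 + 3)) ZH fne fr isT isT isT isT.
by rewrite /f /= (negPf L4) !orbF => -> ->.
Qed.

End Patterns.

(** * From the pattern conditions to pancyclicity *)

Lemma has_cycleP (T : finType) (e : rel T) k :
  reflect (has_cycle e k) [exists t : k.-tuple T, uniq t && cycle e t].
Proof.
apply: (iffP existsP) => [[t /andP[ut ct]]|[s [sk us cs]]].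
  by exists t; rewrite size_tuple.
have sk' : size s == k by apply/eqP.
by exists (Tuple sk'); rewrite /= us.
Qed.

Theorem theorem10 (T : finType) (e : rel T) :
  simple_graph e ->
  two_connected e ->
  R_f1_heavy e claw_rel ->
  ~ is_cycle_graph e ->
  (R_f1_heavy e (P_rel 4) \/ R_f1_heavy e (Z_rel 1) \/ R_f1_heavy e (Z_rel 2)) ->
  pancyclic e.
Proof.
move=> [sym irr] [n3 conn conn2] /(claw_heavyP sym irr) clawH ncyc /(z2_heavyP sym irr) z2H.
have tc : two_connected_on e setT.
  split=> [|v x y _ _ _ xv yv]; first by rewrite cardsT.
  apply: connect_sub (conn2 v x y xv yv) => a b abv; apply: connect1.
  by rewrite !inE.
have deg2 u v : u \in [set: T] -> v \in [set: T] -> heavy e u -> heavy e v -> u != v ->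
    #|[set: T]| <= #|[set t in [set: T] | e u t]| + #|[set t in [set: T] | e v t]|.
  have degE w : #|[set t in [set: T] | e w t]| = deg e w by apply: eq_card => t; rewrite !inE.
  by move=> _ _; rewrite /heavy cardsT !degE; lia.
have [s [us sT cs]] := hamiltonian_on sym irr clawH z2H tc deg2.
have sn : size s = #|T| by rewrite -(card_uniqP us); apply: eq_card => t; rewrite sT !inE.
have [/existsP[x xH]|/existsPn light] := boolP [exists x, heavy e x].
  have n0 : 0 < #|T| by lia.
  have [v [vc vs _]] := periodic_of_seq n0 sn us cs.
  have : x \in s by rewrite sT inE.
  rewrite vs => /existsP[i /eqP vi] k kR.
  (* The existence of a cycle of length [k] is decidable, so its absence may be assumed. *)
  apply/has_cycleP; apply: contraT => /has_cycleP nok.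
  exfalso; apply: (heavy_absurd sym irr kR nok clawH z2H (periodic_rot vc i)).
  by rewrite addn0 vi.
apply: light_pancyclic => //; last by exists s.
- move=> c a b d ca cb cd ab da db _ _.
  exact: clawH ca cb cd ab da db (light a) (light b).
move=> a1 a2 a3 a4 a5 e12 e13 e23 e34 e45 n14 n24 _ _.
by apply: z2H e12 e13 e23 e34 e45 n14 n24 _ _; rewrite ?negb_and light.
Qed.
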